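(* Let $n\ge 1$ and let $K,K'\in\mathcal T_n$ be such that the right-angled $n$-tree groups $A_K$ and $A_{K'}$ are both irreducible and maximally branched. Then $A_K$ and $A_{K'}$ are quasi-isometric.
   Context: **The class $\mathcal T_n$.** $\mathcal T_n$ is the smallest class of $n$-dimensional (finite) simplicial complexes such that (i) the $n$-simplex is in $\mathcal T_n$; (ii) if $K_1,K_2\in\mathcal T_n$, then the union of $K_1$ and $K_2$ along any $(n-1)$-simplex (i.e. the complex obtained by identifying an $(n-1)$-simplex of $K_1$ with an $(n-1)$-simplex of $K_2$ by a simplicial isomorphism) is in $\mathcal T_n$. For $n=1$ this is the class of finite trees with at least one edge. **The group $A_K$.** For a finite simplicial graph, the associated right-angled Artin group is the group generated by the vertices, with defining relations that two generators commute whenever they are joined by an edge. For $K\in\mathcal T_n$, $A_K$ is the right-angled Artin group whose presentation graph is the $1$-skeleton of $K$; such a group is called a right-angled $n$-tree group. Finitely generated groups are called quasi-isometric if they are quasi-isometric when equipped with word metrics from finite generating sets. **Reducible / irreducible.** $A_K$ is *reducible* if $K$ has a vertex that is at distance $1$ (in the $1$-skeleton) from all other vertices of $K$ (so that $K$ is a cone and $\mathbb Z$ splits off as a direct factor of $A_K$); otherwise $A_K$ is *irreducible*. **Maximally branched.** $K\in\mathcal T_n$ is *maximally branched* if each $n$-simplex of $K$ has other $n$-simplices glued to it either along exactly one of its $(n-1)$-faces or along all of its $(n-1)$-faces (i.e. the number of its $(n-1)$-faces which are contained in at least one other $n$-simplex of $K$ is either $1$ or $n+1$). $A_K$ is *maximally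 branched* if $K$ is. *)

(* Defs.v *)
From HB Require Import structures.
From mathcomp Require Import all_boot all_order all_algebra.
From mathcomp Require Import generic_quotient boolp reals.

Set Implicit Arguments.
Unset Strict Implicit.
Unset Printing Implicit Defensive.

Import Order.TTheory GRing.Theory Num.Theory.

Record simplicial_complex := SimplicialComplex {
  vert : finType;
  faces : {set {set vert}};
  set0_notin_faces : set0 \notin faces;
  vertex_in_faces : forall v : vert, [set v] \in faces;
  faces_down_closed : forall s t : {set vert},
    s \in faces -> t \subset s -> t != set0 -> t \in faces
}.

Definition simplices (K : simplicial_complex) (k : nat) : {set {set vert K}} :=
  [set s in faces K | #|s| == k.+1].

(* K is the complex obtained from the disjoint union of K1 and K2 by
   identifying the simplex s1 of K1 with the simplex s2 of K2 along phi; phi is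
   only used on s1.  The maps i1, i2 are the inclusions of K1, K2 in K, jointly
   surjective on vertices because every vertex of K is a face.  This determines
   K up to isomorphism. *)
Definition is_gluing (K1 K2 : simplicial_complex)
    (s1 : {set vert K1}) (s2 : {set vert K2}) (phi : vert K1 -> vert K2)
    (K : simplicial_complex) : Prop :=
  [/\ {in s1 &, injective phi}, phi @: s1 = s2 &
      exists (i1 : vert K1 -> vert K) (i2 : vert K2 -> vert K),
        [/\ injective i1, injective i2,
            forall x y, i1 x = i2 y <-> x \in s1 /\ y = phi x &
            faces K = [set i1 @: t | t : {set vert K1} in faces K1]
                  :|: [set i2 @: t | t : {set vert K2} in faces K2]]].

(* n.-1 is the dimension n - 1, since n >= 1 is always assumed. *)
Inductive in_T (n : nat) : simplicial_complex -> Prop :=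
| in_T_simplex (K : simplicial_complex) :
    #|vert K| = n.+1 -> [set: vert K] \in faces K -> in_T n K
| in_T_glue (K1 K2 K : simplicial_complex)
    (s1 : {set vert K1}) (s2 : {set vert K2}) (phi : vert K1 -> vert K2) :
    in_T n K1 -> in_T n K2 ->
    s1 \in simplices K1 n.-1 -> s2 \in simplices K2 n.-1 ->
    is_gluing s1 s2 phi K -> in_T n K.

Definition adjacent (K : simplicial_complex) : rel (vert K) :=
  fun x y => (x != y) && ([set x; y] \in faces K).

Definition reducible (K : simplicial_complex) : Prop :=
  exists v : vert K, forall w : vert K, w != v -> adjacent v w.

Definition irreducible (K : simplicial_complex) : Prop := ~ reducible K.

(* The (n-1)-faces of s along which another n-simplex of K is glued to s. *)
Definition glued_facets (n : nat) (K : simplicial_complex) (s : {set vert K}) :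
    {set {set vert K}} :=
  [set t in simplices K n.-1 | (t \subset s) &&
     [exists s' in simplices K n, (s' != s) && (t \subset s')]].

Definition maximally_branched (n : nat) (K : simplicial_complex) : Prop :=
  forall s, s \in simplices K n ->
    #|glued_facets n s| = 1%N \/ #|glued_facets n s| = n.+1.

(* The letter (x, false) stands for x and (x, true) for its inverse. *)
Definition word (X : Type) := seq (X * bool).

Definition word_inv (X : Type) (w : word X) : word X :=
  rev [seq (a.1, ~~ a.2) | a <- w].

Inductive pres_eq (X : Type) (rels : word X -> word X -> Prop) :
    word X -> word X -> Prop :=
| pres_eq_refl u : pres_eq rels u u
| pres_eq_sym u v : pres_eq rels u v -> pres_eq rels v u
| pres_eq_trans v u w : pres_eq rels u v -> pres_eq rels v w -> pres_eq rels u w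
| pres_eq_cat u u' v v' : pres_eq rels u u' -> pres_eq rels v v' ->
    pres_eq rels (u ++ v) (u' ++ v')
| pres_eq_cancel x b : pres_eq rels [:: (x, b); (x, ~~ b)] [::]
| pres_eq_rel u v : rels u v -> pres_eq rels u v.

Section PresentedGroup.
Variables (X : choiceType) (rels : word X -> word X -> Prop).

Definition pres_eqb : rel (word X) := fun u v => `[< pres_eq rels u v >].

Lemma pres_eqb_refl : reflexive pres_eqb.
Proof. by move=> u; apply/asboolP; exact: pres_eq_refl. Qed.

Lemma pres_eqb_sym : symmetric pres_eqb.
Proof.
by move=> u v; apply/asboolP/asboolP => H; exact: pres_eq_sym.
Qed.

Lemma pres_eqb_trans : transitive pres_eqb.
Proof.
by move=> v u w /asboolP H1 /asboolP H2; apply/asboolP; exact: pres_eq_trans H2.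
Qed.

Canonical pres_equiv : equiv_rel (word X) :=
  EquivRel pres_eqb pres_eqb_refl pres_eqb_sym pres_eqb_trans.

Definition presented_group : Type := {eq_quot pres_equiv}%qT.
HB.instance Definition _ := EqQuotient.on presented_group.
HB.instance Definition _ := Choice.on presented_group.

Local Open Scope quotient_scope.

Lemma pres_piP (u v : word X) :
  (\pi_presented_group u = \pi_presented_group v) <-> pres_eq rels u v.
Proof.
split; first by move=> /eqmodP /asboolP.
by move=> H; apply/eqmodP/asboolP.
Qed.

Lemma pres_repr (u : word X) : pres_eq rels (repr (\pi_presented_group u)) u.
Proof. by apply/pres_piP; rewrite reprK. Qed.

Definition pres_one : presented_group := \pi_presented_group [::].
Definition pres_mul (g h : presented_group) : presented_group :=
  \pi_presented_group (repr g ++ repr h).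
Definition pres_inv (g : presented_group) : presented_group :=
  \pi_presented_group (word_inv (repr g)).

Lemma pres_mulA : associative pres_mul.
Proof.
move=> f g h; apply/pres_piP.
apply: (@pres_eq_trans _ _ (repr f ++ (repr g ++ repr h))).
  by apply: pres_eq_cat; [exact: pres_eq_refl | exact: pres_repr].
rewrite catA; apply: pres_eq_sym.
by apply: pres_eq_cat; [exact: pres_repr | exact: pres_eq_refl].
Qed.

Lemma pres_mul1g : left_id pres_one pres_mul.
Proof.
move=> g; rewrite -[RHS]reprK; apply/pres_piP.
by apply: (pres_eq_cat (u' := [::])); [exact: pres_repr | exact: pres_eq_refl].
Qed.

Lemma pres_mulg1 : right_id pres_one pres_mul.
Proof.
move=> g; rewrite -[RHS]reprK; apply/pres_piP; rewrite -[X in pres_eq _ _ X]cats0.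
by apply: pres_eq_cat; [exact: pres_eq_refl | exact: pres_repr].
Qed.

Lemma word_invK : involutive (@word_inv X).
Proof.
move=> w; rewrite /word_inv map_rev revK -map_comp -[RHS]map_id.
by apply: eq_map => -[x b] /=; rewrite negbK.
Qed.

Lemma word_mulV (w : word X) : pres_eq rels (w ++ word_inv w) [::].
Proof.
elim: w => [|[x b] w IHw]; first exact: pres_eq_refl.
rewrite /word_inv /= rev_cons -cats1 catA -cat1s -[[:: (x, ~~ b)]]cat0s.
apply: (pres_eq_trans (v := [:: (x, b)] ++ ([::] ++ [:: (x, ~~ b)]))).
  apply: pres_eq_cat; first exact: pres_eq_refl.
  by apply: pres_eq_cat; [exact: IHw | exact: pres_eq_refl].
exact: pres_eq_cancel.
Qed.

Lemma pres_mulgV : right_inverse pres_one pres_inv pres_mul.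
Proof.
move=> g; apply/pres_piP.
apply: (pres_eq_trans (v := repr g ++ word_inv (repr g))); last exact: word_mulV.
by apply: pres_eq_cat; [exact: pres_eq_refl | exact: pres_repr].
Qed.

Lemma pres_mulVg : left_inverse pres_one pres_inv pres_mul.
Proof.
move=> g; apply/pres_piP.
apply: (pres_eq_trans (v := word_inv (repr g) ++ word_inv (word_inv (repr g)))).
  by apply: pres_eq_cat; [exact: pres_repr | rewrite word_invK; exact: pres_eq_refl].
exact: word_mulV.
Qed.

HB.instance Definition _ := isGroup.Build presented_group
  pres_mulA pres_mul1g pres_mulg1 pres_mulVg pres_mulgV.

End PresentedGroup.

Definition raag_rels (V : Type) (e : rel V) (u v : word V) : Prop :=
  exists x y, [/\ e x y, u = [:: (x, false); (y, false)] &
                  v = [:: (y, false); (x, false)]].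

Definition raag (V : finType) (e : rel V) : groupType :=
  presented_group (raag_rels e).

Definition n_tree_group (K : simplicial_complex) : groupType :=
  raag (@adjacent K).

Section WordMetric.
Local Open Scope group_scope.
Variables (G : groupType) (S : seq G).

Definition word_value (w : word G) : G :=
  \prod_(a <- w) (if a.2 then a.1^-1 else a.1).

Definition word_over (w : word G) : bool := all (fun a => a.1 \in S) w.

Definition generates : Prop :=
  forall g : G, exists2 w, word_over w & word_value w = g.

Definition has_word_of_size (g : G) (k : nat) : bool :=
  `[< exists w, [/\ word_over w, word_value w = g & size w = k] >].

Lemma has_word_exists (genS : generates) (g : G) :
  exists k, has_word_of_size g k.
Proof.
by case: (genS g) => w Sw wg; exists (size w); apply/asboolP; exists w.
Qed.

Definition word_length (genS : generates) (g : G) : nat :=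
  ex_minn (has_word_exists genS g).

End WordMetric.

Local Open Scope ring_scope.

Definition word_metric (R : realType) (G : groupType) (S : seq G)
    (genS : generates S) (g h : G) : R :=
  (word_length genS (g^-1 * h)%g)%:R.

Definition quasi_isometry (R : realType) (X Y : Type)
    (dX : X -> X -> R) (dY : Y -> Y -> R) (f : X -> Y) : Prop :=
  exists L C : R, [/\ 1 <= L, 0 <= C,
    forall x x', L^-1 * dX x x' - C <= dY (f x) (f x') <= L * dX x x' + C &
    forall y, exists x, dY (f x) y <= C].

(* For finitely generated groups this does not depend on S and T: changing a
   finite generating set changes the word metric up to bi-Lipschitz
   equivalence. *)
Definition quasi_isometric_groups (R : realType) (G H : groupType) : Prop :=
  exists (S : seq G) (T : seq H) (genS : generates S) (genT : generates T)
         (f : G -> H),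
    quasi_isometry (word_metric R genS) (word_metric R genT) f.

(* Main.v *)
Require Import Defs.
From mathcomp Require Import all_boot all_order all_algebra.
From mathcomp Require Import generic_quotient boolp reals zify.

Set Implicit Arguments.
Unset Strict Implicit.
Unset Printing Implicit Defensive.

Import Order.TTheory GRing.Theory Num.Theory.

(** Both groups turn out to be quasi-isometric to one and the same space, the
    universal tree of flats [tree_point n].

    The vertices of [K] have an [n+1]-colouring in which every [n]-simplex is
    rainbow, so that each coset of the group [Z^(n+1)] of an [n]-simplex is a flat
    with coordinates indexed by the colours.  Flats are kept only for the full
    simplices, those glued along all their facets.  Every other [n]-simplex has
    a single glued facet, and brings one new generator [y], which commutes
    exactly with that facet; such a [y] merely links flats.  In this way [A_K]
    becomes a tree of copies of [Z^(n+1)], in which two neighbouring flats are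
    joined along a wall: the wall [x_i = c] of one is matched with the wall
    [x_i = 0] of the other, all coordinates but the [i]-th being the same.  The
    number of flats behind a wall is bounded, and it is not zero because the
    simplex is full; only the wall through which a flat is entered from the
    root may have nothing else behind it.

    The numbers of flats behind the walls are all that distinguishes [K] from
    [K'], and they can be evened out, as in Hilbert's hotel.  Going away from the root,
    among the flats behind a common wall one keeps its place, and its siblings
    wait at its wall [x_i = 0].  The flats waiting at a flat are then put
    behind its walls [x_i = 0, 1, 2, ...], where they make room for themselves by
    moving the flats that were there to later walls.  Every flat is moved once,
    over a bounded distance and without any change of coordinates, and in the
    end there is exactly one flat behind each wall.  This is the bijection
    [slide], with inverse [unslide].

    Points on flats of different simplices may represent the same element of
    [A_K].  That there are no other coincidences is proved with an action of
    [A_K] on these points, rather than with normal forms ([letter_act],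
    [actC]): a generator
    goes from the flats of the root simplex to those of a simplex that contains
    it, makes a step there, and comes back.  The orbit map [reach] and the
    evaluation [ev] of points in the group are then coarsely inverse to each
    other ([reachK], [go_reach]).

    On the side of the complex, [K] is built by adding one simplex [t + v] at a
    time, with a new vertex [v] and an old facet [t] ([stacked]).  The first
    simplex can be any one, hence a full one: if no simplex were full,
    all of them would share their unique glued facet and [K] would be a cone.
    The host of a new simplex is the earliest simplex containing [t], and it is
    automatically full ([host_of_wide]). *)

(** * Coordinates and the universal tree of flats *)

Definition coords n := {ffun 'I_n.+1 -> int}.

Definition upd n (x : coords n) (i : 'I_n.+1) (c : int) : coords n :=
  [ffun j => if j == i then c else x j].

Definition unit_step (b : bool) : int := if b then (-1)%R else 1%R.

Definition shift n (i : 'I_n.+1) (b : bool) (x : coords n) : coords n :=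
  upd x i (x i + unit_step b)%R.

Lemma upd_same n (x : coords n) i c : upd x i c i = c.
Proof. by rewrite ffunE eqxx. Qed.

Lemma upd_other n (x : coords n) i j c : j != i -> upd x i c j = x j.
Proof. by move=> /negPf ji; rewrite ffunE ji. Qed.

Lemma upd_upd n (x : coords n) i c c' : upd (upd x i c) i c' = upd x i c'.
Proof. by apply/ffunP=> j; rewrite !ffunE; case: eqP. Qed.

Lemma upd_id n (x : coords n) i : upd x i (x i) = x.
Proof. by apply/ffunP=> j; rewrite !ffunE; case: eqP => [->|]. Qed.

Lemma updC n (x : coords n) i j c c' : i != j ->
  upd (upd x i c) j c' = upd (upd x j c') i c.
Proof.
move=> ij; apply/ffunP=> l; rewrite !ffunE.
by case: (eqVneq l j) => [->|//]; rewrite eq_sym (negPf ij).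
Qed.

Lemma shift_upd n (x : coords n) i b c : shift i b (upd x i c) = upd x i (c + unit_step b)%R.
Proof. by rewrite /shift upd_same upd_upd. Qed.

Lemma shift_updC n (x : coords n) i j b c : i != j ->
  shift i b (upd x j c) = upd (shift i b x) j c.
Proof. by move=> ij; rewrite /shift upd_other // updC // eq_sym. Qed.

Lemma unit_stepN b : unit_step (~~ b) = (- unit_step b)%R.
Proof. by case: b; rewrite /= ?opprK. Qed.

Lemma shiftK n (i : 'I_n.+1) b : cancel (shift i b) (shift i (~~ b)).
Proof. by move=> x; rewrite shift_upd unit_stepN addrK upd_id. Qed.

Lemma shiftC n (i j : 'I_n.+1) b b' x : shift i b (shift j b' x) = shift j b' (shift i b x).
Proof.
case: (eqVneq i j) => [->|ij]; last first.
  by rewrite [shift j b' x]/shift shift_updC // [RHS]/shift [shift i b x j]upd_other // eq_sym.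
by rewrite /shift !upd_same !upd_upd addrAC.
Qed.

(** Induction over the integers in both directions at once. *)
Lemma int_ind_unit (Q : int -> Prop) :
  Q 0%R -> (forall c b, Q c -> Q (c + unit_step b)%R) -> forall c, Q c.
Proof.
move=> Q0 QS; elim=> [|k IHk|k IHk] //.
  have -> : (k.+1%:Z = k%:Z + unit_step false)%R by rewrite /=; lia.
  exact: QS.
have -> : (- k.+1%:Z = - k%:Z + unit_step true)%R by rewrite /=; lia.
exact: QS.
Qed.

(** A flat is given by the walls that lead to it from the root flat, the last
    one first. *)
Definition flat_path n := seq ('I_n.+1 * int).

Definition tree_point n := (flat_path n * coords n)%type.

(** A child is entered at the wall [0], so that no pairing of walls has to be
    recorded. *)
Variant linked n : tree_point n -> tree_point n -> Prop :=
| linked_shift (p : flat_path n) (x : coords n) i b : linked (p, x) (p, shift i b x)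
| linked_down (p : flat_path n) (x : coords n) i : linked (p, x) ((i, x i) :: p, upd x i 0%R)
| linked_up (p : flat_path n) (x : coords n) i : linked ((i, x i) :: p, upd x i 0%R) (p, x).

(** Distance at most [N] in the graph [linked]. *)
Fixpoint within n (N : nat) (y z : tree_point n) : Prop :=
  if N is N'.+1 then y = z \/ exists2 y', linked y y' & within N' y' z else y = z.

Section Within.
Variable n : nat.
Implicit Types y z : tree_point n.

Lemma within_refl N y : within N y y.
Proof. by case: N => //= N; left. Qed.

Lemma withinS N y z : within N y z -> within N.+1 y z.
Proof.
elim: N y => [|N IHN] y /=; first by left.
by case=> [->|[y' l /IHN w]]; [left|right; exists y'].
Qed.

Lemma within_trans M N y1 y2 y3 :
  within M y1 y2 -> within N y2 y3 -> within (M + N) y1 y3.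
Proof.
elim: M y1 => [|M IHM] y1; first by move->.
case=> [->|[y' l1 w1]] w2; last by right; exists y' => //; exact: IHM w2.
by elim: {IHM} M.+1 => [//|M' IHM]; rewrite addSn; apply: withinS.
Qed.

Lemma within_le M N y z : M <= N -> within M y z -> within N y z.
Proof. by move=> /subnKC <- w; apply: within_trans w (within_refl _ _). Qed.

Lemma linked_sym y z : linked y z -> linked z y.
Proof.
case=> [p x i b|p x i|p x i]; [|exact: linked_up|exact: linked_down].
by rewrite -{2}(shiftK i b x); exact: linked_shift.
Qed.

Lemma linked_within y z : linked y z -> within 1 y z.
Proof. by move=> l; right; exists z. Qed.

Lemma within_sym N y z : within N y z -> within N z y.
Proof.
elim: N y => [|N IHN] y /=; first by move->.
case=> [->|[y' l /IHN w]]; first by left.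
have := within_trans w (linked_within (linked_sym l)).
by rewrite addn1.
Qed.

Lemma within_upd p (x : coords n) i c c' :
  within `|c - c'|%N (p, upd x i c) (p, upd x i c').
Proof.
have [d] : exists d, c' = (c + d)%R by exists (c' - c)%R; lia.
move=> ->; have -> : `|(c - (c + d))%R|%N = `|d|%N by lia.
have key b k : within k (p, upd x i c) (p, upd x i (c + k%:Z * unit_step b)%R).
  elim: k => [|k IHk]; first by rewrite mul0r addr0.
  rewrite -addn1; apply: within_trans IHk _.
  have -> : (c + (k + 1)%:Z * unit_step b = c + k%:Z * unit_step b + unit_step b)%R by lia.
  rewrite -shift_upd; apply: linked_within; exact: linked_shift.
case: (lerP 0 d) => d0.
  have := key false `|d|%N; congr (within _ _ (_, upd _ _ _)); rewrite /=; lia.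
have := key true `|d|%N; congr (within _ _ (_, upd _ _ _)); rewrite /=; lia.
Qed.

End Within.

Arguments within : simpl never.

(** * Trees of flats with several neighbours *)

(** [(k, b)] stands for the [k]-th gluing, crossed in one of its two directions. *)
Definition edge := (nat * bool)%type.

Definition rev_edge (e : edge) : edge := (e.1, ~~ e.2).

Lemma rev_edgeK : involutive rev_edge.
Proof. by case=> k b; rewrite /rev_edge negbK. Qed.

(** Recipe for a complex: simplex [k.+1] is glued to simplex [host k], along
    the facet missing the colour [side k].  [wide k] tells that simplex [k.+1]
    has flats of its own; otherwise its new vertex is a loop at [host k]. *)
Record assembly (n : nat) := Assembly {
  nsteps : nat;
  host : nat -> nat;
  side : nat -> 'I_n.+1;
  wide : nat -> bool
}.

Section Flats.
Variables (n : nat) (A : assembly n).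
Implicit Types (e : edge) (i : 'I_n.+1) (c : int).
Implicit Types y : flat_path n.

Definition edge_side (e : edge) : 'I_n.+1 := side A e.1.

Definition edge_target (e : edge) : nat :=
  if wide A e.1 && ~~ e.2 then e.1.+1 else host A e.1.

Definition edge_source (e : edge) : nat := edge_target (rev_edge e).

Definition edges_from (q : nat) (i : 'I_n.+1) : seq edge :=
  [seq e <- [seq (k, b) | k <- iota 0 (nsteps A), b <- [:: false; true]] |
    (edge_source e == q) && (edge_side e == i)].

Definition flat := seq (edge * int).

Implicit Types p g : flat.

Definition flat_type (p : flat) : nat :=
  if p is (e, _) :: _ then edge_target e else 0.

(** The wall from which [p] was entered has coordinate [0] in [p], and the edge
    back through it is the reverse of the edge of arrival. *)
Definition leads_back (e : edge) (c : int) (p : flat) : bool :=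
  (c == 0%R) && (if p is (e', _) :: _ then e' == rev_edge e else false).

Fixpoint reduced (p : flat) : bool :=
  if p is (e, c) :: p' then reduced p' && ~~ leads_back e c p' else true.

(** The edges of [p] form a path from simplex [0] in the graph of full
    simplices. *)
Fixpoint typed (p : flat) : bool :=
  if p is (e, c) :: p' then
    typed p' && (e \in edges_from (flat_type p') (edge_side e))
  else true.

Lemma mem_edges_from e q i :
  e \in edges_from q i = [&& e.1 < nsteps A, edge_source e == q & edge_side e == i].
Proof.
rewrite mem_filter andbC; congr (_ && _); apply/allpairsP/idP=> [[[k b] [/= lt_k _ ->]]|].
  by rewrite mem_iota in lt_k.
by case: e => k b /= lt_k; exists (k, b); split=> //=; rewrite ?mem_iota //; case: b.
Qed.

Lemma uniq_edges_from q i : uniq (edges_from q i).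
Proof. apply: filter_uniq; apply: allpairs_uniq => //; first exact: iota_uniq.
by move=> -[k b] [k' b'] _ _ [-> ->]. Qed.

Lemma size_edges_from q i : size (edges_from q i) <= (nsteps A).*2.
Proof.
by rewrite size_filter (leq_trans (count_size _ _)) // size_allpairs size_iota muln2.
Qed.

(** * Shuffling the neighbours of a flat *)

Definition children (p : flat) (i : 'I_n.+1) (c : int) : seq flat :=
  [seq (e, c) :: p | e <- edges_from (flat_type p) i & ~~ leads_back e c p].

(** A flat, together with the flats that wait at it, sorted by the colour of
    the walls behind which they have to be put. *)
Definition arrival := (flat * ('I_n.+1 -> seq flat))%type.

Implicit Type s : arrival.

(** The children behind the walls [0] join the waiting flats, because the wall
    of entrance may have none. *)
Definition arrive i (p : flat) (W : seq flat) : arrival :=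
  (p, fun j => (if j == i then W else [::]) ++ children p j 0).

(** The new neighbour behind the wall [x_i = c].  On the nonnegative side the
    waiting flats come first, then the first children of the walls [1], [2], ...;
    the other children of a wall wait at the first one. *)
Definition slot (s : arrival) i c : arrival :=
  let first_child c' := let o := children s.1 i c' in
    arrive i (head [::] o) (behead o) in
  match c with
  | Posz k => if k < size (s.2 i) then arrive i (nth [::] (s.2 i) k) [::]
              else first_child (Posz (k - size (s.2 i)).+1)
  | Negz _ => first_child c
  end.

Arguments slot : simpl never.

Fixpoint slide (y : flat_path n) : arrival :=
  if y is (i, c) :: y' then slot (slide y') i c
  else ([::], fun j => children [::] j 0).

(** The wall behind which the first child of the wall [c] ends up when [w] flats
    are waiting. *)
Definition head_slot (w : nat) (c : int) : int :=
  if c is Posz k.+1 then Posz (k + w) else c.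

(** The three cases are those of [slot]: a child behind a wall [0] has waited at
    its parent, a first child has only been shifted, and any other child has
    waited at the first one. *)
Fixpoint unslide (p : flat) : flat_path n :=
  if p is (e, c) :: p' then
    let i := edge_side e in
    let y := unslide p' in
    if c == 0%R then (i, Posz (index p ((slide y).2 i))) :: y
    else let y1 := (i, head_slot (size ((slide y).2 i)) c) :: y in
      if p == head [::] (children p' i c) then y1
      else (i, Posz (index p ((slide y1).2 i))) :: y1
  else [::].

Definition good p := reduced p && typed p.

(** The simplices that have flats: the root and the full ones. *)
Definition flat_index (q : nat) : bool :=
  if q is k.+1 then (k < nsteps A) && wide A k else true.

(** What makes the shuffling of neighbours possible; [edges_from_neq0] is where
    fullness of the simplices is used. *)
Record branching : Prop := Branching {
  host_le : forall k, k < nsteps A -> host A k <= k;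
  host_flat : forall k, k < nsteps A -> flat_index (host A k);
  edges_from_neq0 : forall q i, flat_index q -> edges_from q i != [::]
}.

Lemma mem_children p i c g : good p -> g \in children p i c ->
  exists e, [/\ g = (e, c) :: p, edge_side e = i & good g].
Proof.
move=> /andP[rp tp] /mapP[e]; rewrite mem_filter => /andP[nb e_out] ->.
have := e_out; rewrite mem_edges_from => /and3P[_ _ /eqP side_e].
by exists e; rewrite /good /= rp nb tp side_e.
Qed.

Lemma children_mem p e c : good ((e, c) :: p) -> (e, c) :: p \in children p (edge_side e) c.
Proof.
move=> /andP[/= /andP[_ nb] /andP[_ e_out]].
by apply/mapP; exists e => //; rewrite mem_filter nb.
Qed.

Lemma uniq_children p i c : uniq (children p i c).
Proof. by rewrite map_inj_uniq; [exact/filter_uniq/uniq_edges_from|move=> e e' []]. Qed.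

Lemma size_children p i c : size (children p i c) <= (nsteps A).*2.
Proof.
by rewrite size_map size_filter (leq_trans (count_size _ _)) ?size_edges_from.
Qed.

Hypothesis brA : branching.

Lemma flat_index_target e : e.1 < nsteps A -> flat_index (edge_target e).
Proof.
move=> lt_e; rewrite /edge_target; case: ifP => [/andP[w _]|_]; first by rewrite /= lt_e.
exact: (host_flat brA).
Qed.

Lemma flat_index_type p : typed p -> flat_index (flat_type p).
Proof.
case: p => [|[e c] p] //= /andP[_]; rewrite mem_edges_from => /and3P[lt_e _ _].
exact: flat_index_target.
Qed.

Lemma children_neq0 p i c : good p -> c != 0%R -> children p i c != [::].
Proof.
move=> /andP[_ tp] /negPf c0; rewrite /children.
rewrite (eq_filter (a2 := predT)) ?filter_predT; last by move=> e; rewrite /leads_back c0.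
by have := edges_from_neq0 brA i (flat_index_type tp); case: edges_from.
Qed.

Lemma first_child p i c : good p -> c != 0%R ->
  exists e, [/\ head [::] (children p i c) = (e, c) :: p, edge_side e = i,
    good ((e, c) :: p) &
    children p i c = ((e, c) :: p) :: behead (children p i c)].
Proof.
move=> gp c0; have := children_neq0 i gp c0; have := @mem_children p i c.
case: (children p i c) => [|g l] //= /(_ g gp); rewrite mem_head => /(_ isT)[e [-> <- gg]] _.
by exists e.
Qed.

Lemma slide_waiting y i :
  exists W, (slide y).2 i = W ++ children (slide y).1 i 0%R.
Proof.
case: y => [|[j c] y] /=; first by exists [::].
by rewrite /slot /arrive; case: c => [k|k] /=; [case: ifP => _|]; eexists.
Qed.

(** A flat that waits at [p] is either a child of [p] behind a wall [0] or a
    sibling of [p] behind the same wall; hence it is never far from [p]. *)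
Definition neighbours p g i :=
  (exists e, [/\ g = (e, 0%R) :: p, edge_side e = i & good g]) \/
  exists e e' c f, [/\ p = (e, c) :: f, g = (e', c) :: f,
    edge_side e = i, edge_side e' = i & good g].

Definition slide_inv y :=
  [/\ good (slide y).1, unslide (slide y).1 = y &
    forall i, [/\ uniq ((slide y).2 i), size ((slide y).2 i) <= (nsteps A).*2 + (nsteps A).*2 &
    forall g, g \in (slide y).2 i ->
      neighbours (slide y).1 g i /\ unslide g = (i, Posz (index g ((slide y).2 i))) :: y]].

Lemma slot_waiting s i k : k < size (s.2 i) -> slot s i (Posz k) =
  arrive i (nth [::] (s.2 i) k) [::].
Proof. by rewrite /slot => ->. Qed.

Lemma slot_child s i (c : int) : c != 0%R -> slot s i (head_slot (size (s.2 i)) c) =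
  arrive i (head [::] (children s.1 i c)) (behead (children s.1 i c)).
Proof.
by case: c => [[|k]|k] //= _; rewrite /slot ltnNge leq_addl /= addnK.
Qed.

Lemma slot_cases s i (c : int) :
  (exists2 k, c = Posz k & k < size (s.2 i)) \/
  exists2 c', c' != 0%R & c = head_slot (size (s.2 i)) c'.
Proof.
case: c => [k|k]; last by right; exists (Negz k).
case: (ltnP k (size (s.2 i))) => [lt_k|le_k]; first by left; exists k.
right; exists (Posz (k - size (s.2 i)).+1) => //=; by rewrite subnK.
Qed.

Lemma slide_inv_own y j : good (slide y).1 -> unslide (slide y).1 = y ->
  forall g, g \in children (slide y).1 j 0%R ->
  neighbours (slide y).1 g j /\ unslide g = (j, Posz (index g ((slide y).2 j))) :: y.
Proof.
move=> gp uy g /(mem_children gp) [e [-> <- gg]]; split; first by left; exists e.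
by rewrite /= uy.
Qed.

(** The positions of the waiting flats have to be controlled together with that
    of the current flat, since a waiting flat is only placed one step later. *)
Lemma slide_invP y : slide_inv y.
Proof.
elim: y => [|[i c] y [gp uy wy]].
  split=> // i; split; [exact: uniq_children | | exact: (@slide_inv_own [::] i)].
  by rewrite (leq_trans (size_children _ _ _)) ?leq_addr.
have [uniq_w size_w w_y] := wy i.
(* Either a waiting flat is placed, or the first child of a wall. *)
case: (slot_cases (slide y) i c) => [[k def_c lt_k]|[c' c'0 def_c]].
  have def_s : slide ((i, c) :: y) = arrive i (nth [::] ((slide y).2 i) k) [::].
    by rewrite /= def_c slot_waiting.
  have [nb ug] := w_y _ (mem_nth [::] lt_k); rewrite index_uniq // in ug.
  have gg : good (slide ((i, c) :: y)).1.
    by rewrite def_s; case: nb => [[e [_ _ ->]]|[e [e' [c' [f [_ _ _ _ ->]]]]]].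
  have uyc : unslide (slide ((i, c) :: y)).1 = (i, c) :: y by rewrite def_s ug def_c.
  split=> // j; have def_w : (slide ((i, c) :: y)).2 j = children (slide ((i, c) :: y)).1 j 0%R.
    by rewrite def_s /=; case: ifP.
  rewrite def_w; split; first exact: uniq_children.
    by rewrite (leq_trans (size_children _ _ _)) ?leq_addr.
  by rewrite -def_w => g; rewrite {1}def_w; exact: slide_inv_own.
have [e [def_h side_e gg def_o]] := first_child i gp c'0.
set o := children _ _ _ in def_h def_o.
have def_s : slide ((i, c) :: y) = arrive i ((e, c') :: (slide y).1) (behead o).
  by rewrite /= def_c slot_child // def_h.
have g1 : good (slide ((i, c) :: y)).1 by rewrite def_s.
have u1 : unslide (slide ((i, c) :: y)).1 = (i, c) :: y.
  by rewrite def_s /= uy (negPf c'0) side_e -/o def_h eqxx -def_c.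
split=> // j; have def_w : (slide ((i, c) :: y)).2 j =
    (if j == i then behead o else [::]) ++ children (slide ((i, c) :: y)).1 j 0%R.
  by rewrite def_s.
have uniq_o : uniq (behead o).
  by have := uniq_children (slide y).1 i c'; rewrite -/o def_o => /andP[].
have o_sib g : g \in behead o ->
    exists e', [/\ g = (e', c') :: (slide y).1, edge_side e' = i, good g & g != head [::] o].
  move=> go; have go' : g \in o by rewrite def_o inE go orbT.
  have [e' [def_g side' gg']] := mem_children gp go'; exists e'; split=> //.
  apply: contraTneq go => ->; rewrite def_h.
  by have := uniq_children (slide y).1 i c'; rewrite -/o def_o /= => /andP[].
split.
(* Siblings of the current flat and its children have paths of different lengths. *)
- rewrite def_w cat_uniq uniq_children andbT; case: eqP => [_|_] //=; last by apply/hasPn.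
  rewrite uniq_o /=; apply/hasPn=> g /(mem_children g1) [e1 [-> _ _]].
  apply/negP=> /o_sib [e' [/(congr1 size)]]; rewrite def_s /= => /eqP.
  by rewrite !eqSS -[X in _ == X]addn0 -addn1 eqn_add2l.
- rewrite def_w size_cat leq_add ?size_children //.
  case: eqP => // _; rewrite size_behead (leq_trans (leq_pred _)) //; exact: size_children.
move=> g; rewrite {1}def_w mem_cat => /orP[]; last exact: slide_inv_own.
case: eqP => // -> /o_sib[e' [def_g side' gg' gh]]; split.
  by right; exists e, e', c', (slide y).1; rewrite def_s.
rewrite def_g in gh *; rewrite [unslide _]/= uy (negPf c'0) side' -/o (negPf gh) -def_c.
by [].
Qed.

Lemma slideK : cancel (fun y => (slide y).1) unslide.
Proof. by move=> y; have [] := slide_invP y. Qed.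

Lemma good_slide y : good (slide y).1.
Proof. by have [] := slide_invP y. Qed.

Lemma unslideK p : good p -> (slide (unslide p)).1 = p.
Proof.
elim: p => [|[e c] p IHp] // gp.
have gp' : good p by have /andP[/= /andP[rp _] /andP[tp _]] := gp; rewrite /good rp tp.
have {IHp} def_p := IHp gp'; have g_in := children_mem gp.
(* Children of the wall 0 wait at their parent, the others are first or not. *)
rewrite /=; case: (eqVneq c 0%R) => [c0|c0].
  have [W def_w] := slide_waiting (unslide p) (edge_side e).
  have g_w : (e, c) :: p \in (slide (unslide p)).2 (edge_side e).
    by rewrite def_w def_p mem_cat -c0 g_in orbT.
  by rewrite /= slot_waiting ?index_mem //= nth_index.
have def_s : slide ((edge_side e, head_slot (size ((slide (unslide p)).2 (edge_side e))) c)
      :: unslide p) = arrive (edge_side e) (head [::] (children p (edge_side e) c))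
    (behead (children p (edge_side e) c)).
  by rewrite /= slot_child // def_p.
have [e1 [def_h _ _ def_o]] := first_child (edge_side e) gp' c0.
case: eqP => [def_g|ne_h]; first by rewrite def_s /= -def_g.
rewrite /= in def_s; rewrite /= def_s slot_waiting.
  rewrite /= nth_index //= eqxx mem_cat; apply/orP; left.
  by move: g_in; rewrite {1}def_o -def_h inE => /predU1P[].
rewrite index_mem /= eqxx mem_cat; apply/orP; left.
by move: g_in; rewrite {1}def_o -def_h inE => /predU1P[].
Qed.

End Flats.

(** * Crossing walls *)

Section Crossing.
Variables (n : nat) (A : assembly n).
Implicit Types (e : edge) (i : 'I_n.+1) (c : int) (p : flat).

Definition flat_point := (flat * coords n)%type.
Implicit Types z : flat_point.

(** Crossing the wall of [e] through [z]: either back to the flat from which the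
    present one was entered, or on to a new flat. *)
Definition cross e z : flat_point :=
  let i := edge_side A e in
  if leads_back e (z.2 i) z.1
  then (behead z.1, upd z.2 i (head (e, 0%R) z.1).2)
  else ((e, z.2 i) :: z.1, upd z.2 i 0%R).

Arguments cross : simpl never.

Definition move i b z : flat_point := (z.1, shift i b z.2).

Lemma cross_reduced e z : reduced z.1 -> reduced (cross e z).1.
Proof.
case: z => p x rp; rewrite /cross; case: ifP => [|nb] /=; last by rewrite rp nb.
by case: p rp => [|[e' c] p] //= /andP[].
Qed.

(** Crossing forth and back cancels for a purely combinatorial reason: pushing
    and popping the last step of a reduced path. *)
Lemma crossK e z : reduced z.1 -> cross (rev_edge e) (cross e z) = z.
Proof.
case: z => p x rp; have side_rev : edge_side A (rev_edge e) = edge_side A e by [].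
rewrite {2}/cross /=; case: ifP => [|_].
  rewrite /leads_back => /andP[/eqP x0]; case: p rp => [|[e' c] p] //= /andP[_ nb] /eqP def_e'.
  rewrite def_e' in nb.
  by rewrite /cross side_rev /= upd_same (negPf nb) upd_upd -x0 upd_id def_e'.
by rewrite /cross side_rev /= upd_same /leads_back rev_edgeK !eqxx /= upd_upd upd_id.
Qed.

(** A wall is parallel to all directions but its own. *)
Lemma cross_move e i b z : i != edge_side A e ->
  cross e (move i b z) = move i b (cross e z).
Proof.
case: z => p x ie; rewrite /cross /move /=.
rewrite /shift upd_other 1?eq_sym //; case: ifP => _ /=.
  by rewrite upd_other // [in RHS]updC // eq_sym.
by rewrite upd_other // [in RHS]updC // eq_sym.
Qed.

Lemma moveK i b : cancel (move i b) (move i (~~ b)).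
Proof. by case=> p x; rewrite /move /= shiftK. Qed.

Lemma moveC i j b b' z : move i b (move j b' z) = move j b' (move i b z).
Proof. by rewrite /move /= shiftC. Qed.

Lemma cross_child e p (x : coords n) : good A ((e, x (edge_side A e)) :: p) ->
  cross e (p, x) = ((e, x (edge_side A e)) :: p, upd x (edge_side A e) 0%R).
Proof. by move=> /andP[/= /andP[_ nb] _]; rewrite /cross /= (negPf nb). Qed.

Variant cross_spec e z : flat_point -> Prop :=
| CrossBack c p of z.1 = (rev_edge e, c) :: p & z.2 (edge_side A e) = 0%R :
    cross_spec e z (p, upd z.2 (edge_side A e) c)
| CrossChild of good A ((e, z.2 (edge_side A e)) :: z.1) :
    cross_spec e z ((e, z.2 (edge_side A e)) :: z.1, upd z.2 (edge_side A e) 0%R).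

Lemma crossP e z : good A z.1 -> e \in edges_from A (flat_type A z.1) (edge_side A e) ->
  cross_spec e z (cross e z).
Proof.
case: z => p x gp e_out; rewrite /cross /=; case: ifP => [|nb].
  rewrite /leads_back => /andP[/eqP x0]; case: p gp e_out => [|[e' c] p] //= _ _ /eqP def_e'.
  by rewrite def_e'; apply: (@CrossBack e (_, x) c p).
by apply: (@CrossChild e (p, x)); rewrite /good /= nb e_out !andbT.
Qed.

Lemma cross_good e z : good A z.1 -> e \in edges_from A (flat_type A z.1) (edge_side A e) ->
  good A (cross e z).1 /\ flat_type A (cross e z).1 = edge_target A e.
Proof.
move=> gz e_out; case: (crossP gz e_out) => [c p def_z _|//] /=.
have := gz; rewrite /good def_z /= mem_edges_from => /and3P[/andP[-> _] ->].
by rewrite /edge_source rev_edgeK => /and3P[_ /eqP-> _].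
Qed.

Hypothesis brA : branching A.

Definition unslide_point z : tree_point n := (unslide A z.1, z.2).

(** Siblings and children of a wall [0] may wait; one is added because first
    children move by one wall even when no flat is waiting. *)
Definition waiting_bound : nat := ((nsteps A).*2 + (nsteps A).*2).+1.

Definition cross_bound : nat := waiting_bound.+1 + waiting_bound.+1.

Lemma within_enter (y : flat_path n) (x : coords n) i c N : `|x i - c|%N <= N ->
  within N.+1 (y, x) ((i, c) :: y, upd x i 0%R).
Proof.
move=> le_c; rewrite -addn1; apply: (@within_trans _ _ _ _ (y, upd x i c)).
  by rewrite -{1}(upd_id x i); apply: within_le le_c (within_upd _ _ _ _ _).
apply: linked_within; have := linked_down y (upd x i c) i.
by rewrite upd_same upd_upd.
Qed.

Lemma size_waiting (y : flat_path n) i : size ((slide A y).2 i) < waiting_bound.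
Proof. by have [_ _ /(_ i) []] := slide_invP brA y. Qed.

(** A flat is displaced by at most the number of flats that wait somewhere;
    a child that is not the first one is reached in two steps. *)
Lemma unslide_child e p (x : coords n) : good A ((e, x (edge_side A e)) :: p) ->
  within cross_bound (unslide A p, x)
    (unslide A ((e, x (edge_side A e)) :: p), upd x (edge_side A e) 0%R).
Proof.
set i := edge_side A e => gp; have le_w := size_waiting.
have gp' : good A p by have /andP[/= /andP[rp _] /andP[tp _]] := gp; rewrite /good rp tp.
have g_in := children_mem gp; rewrite -/i in g_in.
rewrite /= -/i /cross_bound; case: (eqVneq (x i) 0%R) => [x0|x0].
  apply: within_le (leq_addr _ _) (within_enter _ _).
  rewrite x0; set k := index _ _; have -> : `|(0 - Posz k)%R|%N = k by lia.
  exact: leq_trans (index_size _ _) (ltnW (le_w (unslide A p) i)).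
have le_h : `|(x i - head_slot (size ((slide A (unslide A p)).2 i)) (x i))%R|%N <= waiting_bound.
  apply: leq_trans (le_w (unslide A p) i); move: (size _) => w; case: (x i) => [[|k]|k] /=; lia.
case: eqP => _; first exact: within_le (leq_addr _ _) (within_enter _ le_h).
apply: within_trans (within_enter _ le_h) _.
set s := slot _ _ _ _; set k := index _ _; set y1 := _ :: unslide A p.
have := @within_enter y1 (upd x i 0%R) i (Posz k) waiting_bound.
rewrite upd_same upd_upd; have -> : `|(0 - Posz k)%R|%N = k by lia.
by apply; exact: leq_trans (index_size _ _) (ltnW (le_w y1 i)).
Qed.

Lemma unslide_cross e z : good A z.1 -> e \in edges_from A (flat_type A z.1) (edge_side A e) ->
  within cross_bound (unslide_point z) (unslide_point (cross e z)).
Proof.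
case: z => p x gp e_out; case: (crossP gp e_out) => [c p' /= def_p x0|/= gp'].
  apply: within_sym; rewrite /unslide_point /= def_p.
  have := @unslide_child (rev_edge e) p' (upd x (edge_side A e) c).
  have -> : edge_side A (rev_edge e) = edge_side A e by [].
  have -> : upd (upd x (edge_side A e) c) (edge_side A e) 0%R = x by rewrite upd_upd -x0 upd_id.
  by rewrite upd_same; apply; rewrite -def_p.
exact: unslide_child.
Qed.

Lemma unslide_move i b z : within 1 (unslide_point z) (unslide_point (move i b z)).
Proof. by case: z => p x; apply: linked_within; apply: linked_shift. Qed.

End Crossing.

(** * Word metrics *)

Section WordMetricTheory.
Local Open Scope group_scope.
Variables (G : groupType) (S : seq G) (genS : generates S).

Definition dist (g h : G) : nat := word_length genS (g^-1 * h).

Lemma word_value_cat (v w : word G) : word_value (v ++ w) = word_value v * word_value w.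
Proof. exact: big_cat. Qed.

Lemma word_length_le (w : word G) g : word_over S w -> word_value w = g ->
  word_length genS g <= size w.
Proof.
move=> Sw wg; rewrite /word_length; case: ex_minnP => k _; apply.
by apply/asboolP; exists w.
Qed.

Lemma word_length_attained g :
  exists w, [/\ word_over S w, word_value w = g & size w = word_length genS g].
Proof. by rewrite /word_length; case: ex_minnP => k /asboolP. Qed.

Lemma dist_le_word g w : word_over S w -> dist g (g * word_value w) <= size w.
Proof. by move=> Sw; rewrite /dist mulKg; exact: word_length_le. Qed.

Lemma dist_word g h :
  exists w, [/\ word_over S w, h = g * word_value w & size w = dist g h].
Proof.
by have [w [Sw wg sw]] := word_length_attained (g^-1 * h); exists w; rewrite wg mulVKg.
Qed.

Lemma dist_trans g h k : dist g k <= dist g h + dist h k.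
Proof.
have [v [Sv -> <-]] := dist_word g h; have [w [Sw -> <-]] := dist_word (g * word_value v) k.
rewrite -mulgA -word_value_cat -size_cat; apply: dist_le_word.
by rewrite /word_over all_cat; apply/andP.
Qed.

Lemma dist_sym_le g h : dist h g <= dist g h.
Proof.
have [w [Sw -> <-]] := dist_word g h; elim: w g Sw => [|[s b] w IHw] g /=.
  rewrite /word_value big_nil mulg1 => _.
  by have := @dist_le_word g [::] isT; rewrite /word_value big_nil mulg1.
move=> /andP[Ss Sw]; rewrite /word_value big_cons mulgA -/(word_value w) /=.
apply: leq_trans (dist_trans _ _ _) _; rewrite -addn1; apply: leq_add; first exact: IHw.
have := @dist_le_word (g * (if b then s^-1 else s)) [:: (s, ~~ b)].
rewrite /= Ss /word_value big_seq1 /=; case: b; rewrite /= ?mulgVK ?mulgK; exact.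
Qed.

Lemma dist_sym g h : dist g h = dist h g.
Proof. by apply/eqP; rewrite eqn_leq !dist_sym_le. Qed.

Lemma dist_refl g : dist g g = 0.
Proof.
by apply/eqP; rewrite -leqn0; have := @dist_le_word g [::] isT; rewrite /word_value big_nil mulg1.
Qed.

Lemma dist_gen g s (b : bool) : s \in S -> dist g (g * (if b then s^-1 else s)) <= 1.
Proof.
move=> Ss; have := @dist_le_word g [:: (s, b)].
by rewrite /= Ss /word_value big_seq1; apply.
Qed.

(** It is enough to control a map on the edges of the Cayley graph. *)
Lemma lipschitz_from_group n (f : G -> tree_point n) N :
  (forall g s, s \in S -> within N (f g) (f (g * s))) ->
  forall g h, within (dist g h * N) (f g) (f h).
Proof.
move=> f_lip g h; have [w [Sw -> <-]] := dist_word g h; elim: w g Sw => [|[s b] w IHw] g /=.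
  by rewrite /word_value big_nil mulg1.
move=> /andP[Ss Sw]; rewrite /word_value big_cons mulgA -/(word_value w) mulSn /=.
apply: within_trans (IHw _ Sw).
case: b => /=; last exact: f_lip.
by rewrite -{1}(mulgVK s g); apply/within_sym/f_lip.
Qed.

Lemma lipschitz_to_group n (f : tree_point n -> G) N :
  (forall y z, linked y z -> dist (f y) (f z) <= N) ->
  forall M y z, within M y z -> dist (f y) (f z) <= M * N.
Proof.
move=> f_lip; elim=> [|M IHM] y z; first by move->; rewrite dist_refl.
case=> [->|[y' l w]]; first by rewrite dist_refl.
apply: leq_trans (dist_trans _ (f y') _) _.
by rewrite mulSn leq_add ?f_lip ?IHM.
Qed.

End WordMetricTheory.

(** This says that [G] is quasi-isometric to [tree_point n], in terms of two
    Lipschitz maps that are coarsely inverse to each other; it is enough to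
    control such maps on the edges of the two graphs. *)
Definition coarse_tree n (G : groupType) : Prop :=
  exists (S : seq G) (genS : generates S) (p : G -> tree_point n) (q : tree_point n -> G) (N : nat),
  [/\ forall g s, s \in S -> within N (p g) (p (g * s)%g),
      forall y z, linked y z -> dist genS (q y) (q z) <= N,
      cancel p q &
      forall y, within N (p (q y)) y].

(** The tree of flats is a common model: going through it and back moves points
    by a bounded amount. *)
Lemma coarse_tree_quasi_isometric (R : realType) n (G H : groupType) :
  coarse_tree n G -> coarse_tree n H -> quasi_isometric_groups R G H.
Proof.
move=> [S [genS [p [q [N [p_lip q_lip pK qK]]]]]] [T [genT [p' [q' [N' [p'_lip q'_lip p'K q'K]]]]]].
exists S, T, genS, genT, (q' \o p).
have up g h : dist genT (q' (p g)) (q' (p h)) <= dist genS g h * N * N'.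
  by have := lipschitz_to_group q'_lip (lipschitz_from_group genS p_lip g h).
have down a b : dist genS (q (p' a)) (q (p' b)) <= dist genT a b * N' * N.
  by have := lipschitz_to_group q_lip (lipschitz_from_group genT p'_lip a b).
have back g : dist genS (q (p' (q' (p g)))) g <= N' * N.
  by have := lipschitz_to_group q_lip (q'K (p g)); rewrite pK.
have onto b : dist genT (q' (p (q (p' b)))) b <= N * N'.
  by have := lipschitz_to_group q'_lip (qK (p' b)); rewrite p'K.
pose L := (N * N').+1; pose C := (N * N' + N * N')%N.
have le_up g h : dist genT (q' (p g)) (q' (p h)) <= L * dist genS g h + C.
  apply: leq_trans (up g h) _; rewrite -mulnA mulnC /L mulSn -addnA.
  by rewrite addnCA leq_addr.
have le_down g h : dist genS g h <= L * (dist genT (q' (p g)) (q' (p h)) + C).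
  apply: leq_trans (dist_trans _ _ (q (p' (q' (p g)))) _) _.
  apply: leq_trans (leq_add (leqnn _) (dist_trans _ _ (q (p' (q' (p h)))) _)) _.
  rewrite [dist _ g _]dist_sym.
  have := down (q' (p g)) (q' (p h)); have := back g; have := back h.
  rewrite -mulnA /L /C (mulnC N' N); nia.
exists L%:R%R, C%:R%R; split.
- by rewrite ler1n.
- by rewrite ler0n.
- move=> g h; rewrite /word_metric /= -/(dist genS g h) -/(dist genT _ _).
  apply/andP; split; last by rewrite -natrM -natrD ler_nat.
  rewrite lerBlDr mulrC ler_pdivrMr ?ltr0n // -natrD -natrM ler_nat mulnC.
  exact: le_down.
- move=> b; exists (q (p' b)); rewrite /word_metric ler_nat /=.
  exact: leq_trans (onto b) (leq_addr _ _).
Qed.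

(** * Presented groups *)

Section Presented.
Variables (X : choiceType) (rels : word X -> word X -> Prop).
Local Open Scope group_scope.
Local Open Scope quotient_scope.

Definition letter (a : X * bool) : presented_group rels := \pi_(presented_group rels) [:: a].

Lemma pi_cat (u v : word X) : \pi_(presented_group rels) (u ++ v) =
  \pi_(presented_group rels) u * \pi_(presented_group rels) v.
Proof.
apply/esym/pres_piP; apply: pres_eq_cat; exact: pres_repr.
Qed.

Lemma pi_rcons (u : word X) a : \pi_(presented_group rels) (rcons u a) =
  \pi_(presented_group rels) u * letter a.
Proof. by rewrite -cats1 pi_cat. Qed.

Lemma letterV x b : letter (x, ~~ b) = (letter (x, b))^-1.
Proof.
apply/esym/mulg1_eq; rewrite -pi_cat; apply/pres_piP; exact: pres_eq_cancel.
Qed.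

Lemma presented_group_ind (Q : presented_group rels -> Prop) :
  Q 1 -> (forall g a, Q g -> Q (g * letter a)) -> forall g, Q g.
Proof.
move=> Q1 QM g; rewrite -[g]reprK; elim/last_ind: (repr g) => [//|w a IHw].
by rewrite pi_rcons; exact: QM.
Qed.

End Presented.

Lemma letterC (V : finType) (adj : rel V) v w b b' : adj v w ->
  commute (letter (raag_rels adj) (v, b)) (letter (raag_rels adj) (w, b')).
Proof.
move=> vw.
have vwC : commute (letter (raag_rels adj) (v, false)) (letter (raag_rels adj) (w, false)).
  rewrite /commute -!pi_cat; apply/pres_piP/pres_eq_rel.
  by exists v, w.
have wP b1 : commute (letter (raag_rels adj) (v, false)) (letter (raag_rels adj) (w, b1)).
  by case: b1 => //; rewrite (letterV _ w false); apply: commuteV.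
case: b => //; rewrite (letterV _ v false); apply/commute_sym/commuteV/commute_sym; exact: wP.
Qed.

(** * The action of the group of an assembly on its tree of flats *)

(** [vtx q i] is the vertex of colour [i] of simplex [q], and [born v] is the
    first simplex that contains [v].  A simplex shares with its host all
    vertices but the new one, and adjacency means a common simplex. *)
Record labelling n (A : assembly n) (V : finType) (adj : rel V)
    (vtx : nat -> 'I_n.+1 -> V) (born : V -> nat) (col : V -> 'I_n.+1) : Prop := Labelling {
  col_vtx : forall q i, q <= nsteps A -> col (vtx q i) = i;
  vtx_host : forall k i, k < nsteps A -> i != side A k -> vtx k.+1 i = vtx (host A k) i;
  born_new : forall k, k < nsteps A -> born (vtx k.+1 (side A k)) = k.+1;
  born_min : forall q i, q <= nsteps A -> born (vtx q i) <= q;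
  born_le : forall v, born v <= nsteps A;
  vtx_born : forall v, vtx (born v) (col v) = v;
  adjP : forall v w, adj v w <->
    exists q i j, [/\ q <= nsteps A, i != j, v = vtx q i & w = vtx q j]
}.

Section Action.
Variables (n : nat) (A : assembly n) (V : finType) (adj : rel V).
Variables (vtx : nat -> 'I_n.+1 -> V) (born : V -> nat) (col : V -> 'I_n.+1).
Hypotheses (brA : branching A) (labA : labelling A adj vtx born col).
Implicit Types (z : flat_point n) (q k : nat) (i j : 'I_n.+1) (b : bool) (v w : V).

(** The first argument bounds the recursion; [host k] is at most [k], so that
    [q] itself is enough fuel. *)
Fixpoint route_rec (fuel q : nat) : seq nat :=
  if fuel is f.+1 then if q is k.+1 then rcons (route_rec f (host A k)) k else [::]
  else [::].

Definition route q := route_rec q q.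

Lemma route_recE f q : q <= f -> q <= nsteps A -> route_rec f q = route q.
Proof.
elim/ltn_ind: q f => -[|k] IHk [|f] //= le_k lt_k.
have le_h := host_le brA lt_k; rewrite /route /=; congr rcons.
rewrite IHk ?(leq_trans le_h) ?(ltnW lt_k) // IHk ?(leq_trans le_h) ?(ltnW lt_k) //.
Qed.

Lemma routeS k : k < nsteps A -> route k.+1 = rcons (route (host A k)) k.
Proof.
move=> lt_k; have le_h := host_le brA lt_k; congr rcons.
by apply: route_recE; rewrite ?(leq_trans le_h) ?(ltnW lt_k).
Qed.

(** Passes from the flats of the root simplex to those of simplex [q] without
    moving in the group: all the walls on the way contain the given point. *)
Definition go q z : flat_point n := foldl (fun z k => cross A (k, false) z) z (route q).

Definition goback q z : flat_point n := foldr (fun k z => cross A (k, true) z) z (route q).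

Lemma goS k z : k < nsteps A -> go k.+1 z = cross A (k, false) (go (host A k) z).
Proof. by move=> lt_k; rewrite /go routeS // foldl_rcons. Qed.

Lemma gobackS k z : k < nsteps A ->
  goback k.+1 z = goback (host A k) (cross A (k, true) z).
Proof. by move=> lt_k; rewrite /goback routeS // foldr_rcons. Qed.

Lemma go_reduced q z : reduced z.1 -> reduced (go q z).1.
Proof. by rewrite /go; elim: (route q) z => //= k l IHl z /(cross_reduced A (k, false))/IHl. Qed.

Lemma foldr_cross_reduced l z :
  reduced z.1 -> reduced (foldr (fun k z => cross A (k, true) z) z l).1.
Proof. by move=> rz; elim: l => //= k l /(cross_reduced A (k, true)). Qed.

Lemma goback_reduced q z : reduced z.1 -> reduced (goback q z).1.
Proof. exact: foldr_cross_reduced. Qed.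

Lemma goK q z : reduced z.1 -> goback q (go q z) = z.
Proof.
rewrite /goback /go; elim: (route q) z => //= k l IHl z rz.
by rewrite IHl ?cross_reduced // (crossK A (k, false)).
Qed.

Lemma gobackK q z : reduced z.1 -> go q (goback q z) = z.
Proof.
move=> rz; rewrite /go /goback; elim: (route q) => //= k l IHl.
by rewrite (crossK A (k, true)) ?foldr_cross_reduced.
Qed.

(** A vertex translates the flats of the simplex in which it is born; if that
    simplex has no flats, the vertex crosses the loop at the host instead. *)
Definition letter_act (a : V * bool) z : flat_point n :=
  let q := born a.1 in
  if flat_index A q then goback q (move (col a.1) a.2 (go q z))
  else goback (host A q.-1) (cross A (q.-1, a.2) (go (host A q.-1) z)).

Lemma act_reduced a z : reduced z.1 -> reduced (letter_act a z).1.
Proof.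
move=> rz; rewrite /letter_act; case: ifP => _; apply: goback_reduced.
  exact: go_reduced.
exact/cross_reduced/go_reduced.
Qed.

Lemma actK v b z : reduced z.1 -> letter_act (v, ~~ b) (letter_act (v, b) z) = z.
Proof.
move=> rz; rewrite /letter_act /=; case: (flat_index A (born v)); rewrite gobackK.
- by rewrite moveK goK.
- exact/go_reduced.
- by rewrite (crossK A (_, b)) ?goK ?go_reduced.
- exact/cross_reduced/go_reduced.
Qed.

(** The action of a vertex can be computed in any of its simplices with flats,
    because the walls between two such simplices are parallel to its direction.
    This is what makes the commutation relations hold. *)
Lemma act_vtx q i b z : q <= nsteps A -> flat_index A q -> reduced z.1 ->
  letter_act (vtx q i, b) z = goback q (move i b (go q z)).
Proof.
elim/ltn_ind: q z => -[|k] IHk z lt_k flat_k rz.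
  have b0 : born (vtx 0 i) = 0 by apply/eqP; rewrite -leqn0 (born_min labA).
  by rewrite /letter_act /= b0 (col_vtx labA).
case: (eqVneq i (side A k)) => [->|ik].
  by rewrite /letter_act /= (born_new labA) // (col_vtx labA) // flat_k.
(* An old vertex belongs to the host and commutes with the crossing from there. *)
rewrite (vtx_host labA) // IHk ?host_flat //; last 2 first.
- by rewrite ltnS (host_le brA).
- exact: leq_trans (host_le brA lt_k) (ltnW lt_k).
rewrite goS // gobackS // (@cross_move _ A (k, true)) // (crossK A (k, false)) //.
exact: go_reduced.
Qed.

Lemma act_new k b z : k < nsteps A -> ~~ wide A k ->
  letter_act (vtx k.+1 (side A k), b) z =
  goback (host A k) (cross A (k, b) (go (host A k) z)).
Proof. by move=> lt_k /negPf wk; rewrite /letter_act /= (born_new labA) //= lt_k wk. Qed.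

Lemma act_newC k i b b' z : k < nsteps A -> ~~ wide A k -> i != side A k -> reduced z.1 ->
  letter_act (vtx k.+1 i, b') (letter_act (vtx k.+1 (side A k), b) z) =
  letter_act (vtx k.+1 (side A k), b) (letter_act (vtx k.+1 i, b') z).
Proof.
move=> lt_k wk ik rz; have le_h : host A k <= nsteps A := leq_trans (host_le brA lt_k) (ltnW lt_k).
have flat_h := host_flat brA lt_k; rewrite (vtx_host labA lt_k ik) act_new //.
rewrite [LHS]act_vtx ?goback_reduced ?cross_reduced ?go_reduced //.
rewrite [RHS]act_new //.
rewrite [in RHS]act_vtx //.
rewrite !gobackK //= ?cross_reduced ?go_reduced //.
by rewrite cross_move.
Qed.

(** Two adjacent vertices lie in a common simplex: either they translate the
    same flats, or one of them crosses a wall parallel to the other. *)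
Lemma actC v w b b' z : adj v w -> reduced z.1 ->
  letter_act (w, b') (letter_act (v, b) z) = letter_act (v, b) (letter_act (w, b') z).
Proof.
move=> /(adjP labA) [q [i [j [le_q ij -> ->]]]] rz.
have flatC q0 b1 b2 : q0 <= nsteps A -> flat_index A q0 ->
    letter_act (vtx q0 j, b1) (letter_act (vtx q0 i, b2) z) =
    letter_act (vtx q0 i, b2) (letter_act (vtx q0 j, b1) z).
  move=> le_q0 flat_q0; rewrite !act_vtx ?goback_reduced //= ?go_reduced //.
  by rewrite !gobackK //= ?go_reduced // moveC.
case: (boolP (flat_index A q)) => [|]; first exact: flatC.
case: q le_q => [|k] //= lt_k; rewrite lt_k /= => wk.
case: (eqVneq i (side A k)) ij => [->|ik] ij; first by rewrite act_newC 1?eq_sym.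
case: (eqVneq j (side A k)) ij => [->|jk] ij; first by rewrite act_newC.
have lt_h : host A k <= nsteps A := leq_trans (host_le brA lt_k) (ltnW lt_k).
by rewrite (vtx_host labA lt_k ik) (vtx_host labA lt_k jk) flatC // host_flat.
Qed.

Lemma down_edge k : k < nsteps A -> wide A k ->
  (k, false) \in edges_from A (host A k) (side A k).
Proof.
by move=> lt_k wk; rewrite mem_edges_from lt_k /edge_source /edge_target /= andbF !eqxx.
Qed.

Lemma up_edge k : k < nsteps A -> wide A k -> (k, true) \in edges_from A k.+1 (side A k).
Proof.
by move=> lt_k wk; rewrite mem_edges_from lt_k /edge_source /edge_target /= wk !eqxx.
Qed.

Lemma loop_edge k b : k < nsteps A -> ~~ wide A k ->
  (k, b) \in edges_from A (host A k) (side A k).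
Proof.
move=> lt_k /negPf wk.
by rewrite mem_edges_from lt_k /edge_source /edge_target /= wk !eqxx.
Qed.

Definition based q z := good A z.1 /\ flat_type A z.1 = q.

Notation uns := (unslide_point A).

Lemma cross_based e z : based (edge_source A e) z -> e.1 < nsteps A ->
  based (edge_target A e) (cross A e z) /\
  within (cross_bound A) (uns z) (uns (cross A e z)).
Proof.
move=> [gz tz] lt_e.
have e_out : e \in edges_from A (flat_type A z.1) (edge_side A e).
  by rewrite mem_edges_from lt_e tz !eqxx.
by split; [exact: cross_good | exact: unslide_cross].
Qed.

Lemma go_based q z : q <= nsteps A -> flat_index A q -> based 0 z ->
  based q (go q z) /\ within (q * cross_bound A) (uns z) (uns (go q z)).
Proof.
elim/ltn_ind: q => -[|k] IHk lt_k; first by split=> //; exact: within_refl.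
rewrite /= lt_k /= => wk bz; have le_h := host_le brA lt_k.
have [bh wh] := IHk _ le_h (leq_trans le_h (ltnW lt_k)) (host_flat brA lt_k) bz.
have src : edge_source A (k, false) = host A k by rewrite /edge_source /edge_target /= andbF.
have tgt : edge_target A (k, false) = k.+1 by rewrite /edge_target /= wk.
have bh' : based (edge_source A (k, false)) (go (host A k) z) by rewrite src.
have [] := cross_based bh' lt_k; rewrite tgt -goS // => bk wk'.
split=> //; rewrite mulSn addnC; apply: within_trans wk'.
by apply: within_le wh; rewrite leq_mul2r le_h orbT.
Qed.

Lemma goback_based q z : q <= nsteps A -> flat_index A q -> based q z ->
  based 0 (goback q z) /\ within (q * cross_bound A) (uns z) (uns (goback q z)).
Proof.
elim/ltn_ind: q z => -[|k] IHk z lt_k; first by split=> //; exact: within_refl.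
rewrite /= lt_k /= => wk bz; have le_h := host_le brA lt_k.
have src : edge_source A (k, true) = k.+1 by rewrite /edge_source /edge_target /= wk.
have tgt : edge_target A (k, true) = host A k by rewrite /edge_target /= andbF.
rewrite -src in bz; have [] := cross_based bz lt_k; rewrite tgt => bk wk'.
have [bh wh] := IHk _ le_h _ (leq_trans le_h (ltnW lt_k)) (host_flat brA lt_k) bk.
rewrite gobackS //; split=> //; rewrite mulSn; apply: within_trans wk' _.
by apply: within_le wh; rewrite leq_mul2r le_h orbT.
Qed.

Definition act_bound : nat := (nsteps A).*2.+1 * cross_bound A.

Lemma flat_index_le q : flat_index A q -> q <= nsteps A.
Proof. by case: q => //= k /andP[]. Qed.

(** A vertex that is born in a simplex without flats is the new vertex of that
    simplex, so that its colour is the side along which this simplex is glued. *)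
Lemma born_host v : ~~ flat_index A (born v) ->
  exists2 k, born v = k.+1 & [/\ k < nsteps A, ~~ wide A k & side A k = col v].
Proof.
have := vtx_born labA v; have := born_le labA v.
case def_v: (born v) => [|k] //= lt_k vtx_v; rewrite lt_k /= => wk; exists k => //; split=> //.
apply/eqP; rewrite eq_sym; apply/negPn/negP=> ne_k.
have := born_min labA (col v) (leq_trans (host_le brA lt_k) (ltnW lt_k)).
by rewrite -(vtx_host labA lt_k ne_k) vtx_v def_v leqNgt ltnS (host_le brA lt_k).
Qed.

Lemma act_based a z : based 0 z ->
  based 0 (letter_act a z) /\ within act_bound (uns z) (uns (letter_act a z)).
Proof.
move=> bz; have through q z1 z2 : q <= nsteps A -> flat_index A q ->
    z1 = go q z -> based q z2 -> within (cross_bound A) (uns z1) (uns z2) ->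
    based 0 (goback q z2) /\ within act_bound (uns z) (uns (goback q z2)).
  move=> le_q flat_q -> b2 w2; have [b1 w1] := go_based le_q flat_q bz.
  have [b3 w3] := goback_based le_q flat_q b2; split=> //.
  apply: within_le (within_trans w1 (within_trans w2 w3)).
  by rewrite /act_bound mulSn addnCA leq_add2l -mulnDl addnn leq_mul2r leq_double le_q orbT.
rewrite /letter_act; case: ifP => [flat_v|/negbT /born_host [k -> [lt_k wk side_k]]].
  have le_v := flat_index_le flat_v; have [b1 w1] := go_based le_v flat_v bz.
  apply: through => //; apply: within_le (unslide_move _ _ _ _).
  by rewrite /cross_bound addnS.
have le_h := leq_trans (host_le brA lt_k) (ltnW lt_k); have flat_h := host_flat brA lt_k.
have [bh _] := go_based le_h flat_h bz.
have end_k c : edge_target A (k, c) = host A k by rewrite /edge_target /= (negPf wk).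
have bh' : based (edge_source A (k, a.2)) (go (host A k) z) by rewrite /edge_source end_k.
have [bc wc] := cross_based bh' lt_k; rewrite end_k in bc.
exact: (through _ _ _ le_h flat_h erefl bc wc).
Qed.

End Action.

(** * Monomials in commuting elements *)

Section Monomials.
Local Open Scope group_scope.
Variable G : groupType.

Definition zpow (g : G) (c : int) : G :=
  match c with Posz k => g ^+ k | Negz k => g ^- k.+1 end.

Lemma commute_zpow (g h : G) c : commute h g -> commute h (zpow g c).
Proof. by case: c => k gh; [exact: commuteX | exact/commuteV/commuteX]. Qed.

Lemma zpow_step (g : G) c b :
  zpow g (c + unit_step b)%R = zpow g c * (if b then g^-1 else g).
Proof.
case: b => /=.
  case: c => [[|k]|k].
  - by rewrite add0r /= expg0 mul1g expg1.
  - have -> : (Posz k.+1 + -1 = Posz k)%R by lia.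
    by rewrite /= expgSr mulgK.
  - have -> : (Negz k + -1 = Negz k.+1)%R by lia.
    by rewrite /= -!expVgn [LHS]expgSr.
case: c => [k|[|k]].
- have -> : (Posz k + 1 = Posz k.+1)%R by lia.
  by rewrite /= expgSr.
- have -> : (Negz 0 + 1 = Posz 0)%R by lia.
  by rewrite /= expg0 expg1 mulVg.
have -> : (Negz k.+1 + 1 = Negz k)%R by lia.
by rewrite /= -!expVgn [in RHS]expgSr mulgVK.
Qed.

Variables (n : nat) (a : 'I_n.+1 -> G).
Hypothesis aC : forall i j, commute (a i) (a j).
Implicit Types (x : coords n) (i : 'I_n.+1) (b : bool).

Definition monomial x : G := \prod_(i < n.+1) zpow (a i) (x i).

(** Commutation allows any coordinate to be moved to the front. *)
Lemma monomial_split x i : monomial x = zpow (a i) (x i) * monomial (upd x i 0%R).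
Proof.
rewrite /monomial; have := mem_index_enum i; have := index_enum_uniq 'I_n.+1.
elim: (index_enum _) => //= j r IHr /andP[jr ur]; rewrite inE !big_cons => /predU1P[->|ir].
  rewrite upd_same mul1g; congr (_ * _); apply: eq_big_seq => l lr; rewrite upd_other //.
  by apply: contraNneq jr => <-.
have ji : j != i by apply: contraNneq jr => ->.
rewrite IHr // upd_other // !mulgA; congr (_ * _).
by apply: commute_zpow; apply/commute_sym/commute_zpow; apply: aC.
Qed.

Lemma commute_monomial h x : (forall i, x i != 0%R -> commute h (a i)) -> commute h (monomial x).
Proof.
move=> hC; apply: commute_prod => i _; case: (eqVneq (x i) 0%R) => [->|/hC]; first exact: commute1.
exact: commute_zpow.
Qed.

Lemma monomial_shift x i b :
  monomial (shift i b x) = monomial x * (if b then (a i)^-1 else a i).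
Proof.
rewrite (monomial_split _ i) /shift upd_same upd_upd zpow_step [in RHS](monomial_split _ i).
rewrite -!mulgA; congr (_ * _); apply: commute_monomial => j _.
by case: b; last exact: aC; apply/commute_sym/commuteV/aC.
Qed.

End Monomials.

Lemma eq_monomial (G : groupType) n (a a' : 'I_n.+1 -> G) (x : coords n) :
  (forall i, x i != 0%R -> a i = a' i) -> monomial a x = monomial a' x.
Proof.
by move=> aa'; apply: eq_bigr => i _; case: (eqVneq (x i) 0%R) => [->//|/aa' ->].
Qed.

Lemma coords_ind n (Q : coords n -> Prop) x0 :
  Q x0 -> (forall x i b, Q x -> Q (shift i b x)) -> forall x, Q x.
Proof.
move=> Q0 QS; have Qupd x i c : Q x -> Q (upd x i c).
  move=> Qx; have -> : c = (x i + (c - x i))%R by lia.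
  elim/int_ind_unit: (c - x i)%R => [|d b Qd]; first by rewrite addr0 upd_id.
  by rewrite addrA -shift_upd; apply: QS.
move=> x; pose y := foldr (fun i y => upd y i (x i)) x0 (enum 'I_n.+1).
have -> : x = y.
  apply/ffunP=> i; rewrite /y; have := mem_enum 'I_n.+1 i.
  elim: (enum _) => //= j r IHr; rewrite inE => /orP[/eqP->|/IHr]; first by rewrite upd_same.
  by case: (eqVneq i j) => [->|ij]; rewrite ?upd_same // upd_other.
by rewrite /y; elim: (enum _) => //= i r; apply: Qupd.
Qed.

(** * Points of the tree of flats as group elements *)

Section Evaluation.
Local Open Scope group_scope.
Local Open Scope quotient_scope.
Variables (n : nat) (A : assembly n) (V : finType) (adj : rel V).
Variables (vtx : nat -> 'I_n.+1 -> V) (born : V -> nat) (col : V -> 'I_n.+1).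
Hypotheses (brA : branching A) (labA : labelling A adj vtx born col).
Implicit Types (z : flat_point n) (q k : nat) (i j : 'I_n.+1) (b : bool) (v w : V).
Implicit Types (e : edge) (x : coords n) (p : flat).

Local Notation G := (raag adj).
Local Notation gen := (letter (raag_rels adj)).
Local Notation act := (letter_act A born col).

Definition act_word (w : word V) z : flat_point n := foldl (fun z a => act a z) z w.

Lemma act_word_reduced (w : word V) z : reduced z.1 -> reduced (act_word w z).1.
Proof. by elim: w z => //= a w IHw z /(act_reduced A born col a)/IHw. Qed.

Lemma act_word_pres (u w : word V) : pres_eq (raag_rels adj) u w ->
  forall z, reduced z.1 -> act_word u z = act_word w z.
Proof.
elim=> {u w} [//|u w _ IH z rz|u w t _ IH1 _ IH2 z rz|u u' w w' _ IH1 _ IH2 z rz|v b z rz|].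
- by rewrite IH.
- by rewrite IH1 // IH2.
- by rewrite /act_word !foldl_cat -!/(act_word _ _) IH1 // IH2 // act_word_reduced.
- by rewrite /= actK.
by move=> _ _ [v [w [vw -> ->]]] z rz; rewrite /= (actC brA labA).
Qed.

Definition base : flat_point n := ([::], [ffun=> 0%R]).

Definition reach (g : G) : flat_point n := act_word (repr g) base.

Lemma reach_pi (w : word V) : reach (\pi_(presented_group (raag_rels adj)) w) = act_word w base.
Proof. by apply: act_word_pres => //; exact: pres_repr. Qed.

Lemma reach1 : reach 1 = base.
Proof. exact: (reach_pi [::]). Qed.

Lemma reach_mul (g : G) a : reach (g * gen a) = act a (reach g).
Proof.
rewrite -[g in LHS]reprK -pi_rcons reach_pi /act_word foldl_rcons; congr (act a _).
Qed.

Lemma reach_based (g : G) : based A 0 (reach g).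
Proof.
elim/presented_group_ind: g => [|g a IHg]; first by rewrite reach1.
by rewrite reach_mul; have [] := act_based brA labA a IHg.
Qed.

Definition vgen q i : G := gen (vtx q i, false).

Lemma genE v b : gen (v, b) = if b then (gen (v, false))^-1 else gen (v, false).
Proof. by case: b => //; rewrite (letterV _ v false). Qed.

Lemma vgenC q i j : q <= nsteps A -> commute (vgen q i) (vgen q j).
Proof.
move=> le_q; case: (eqVneq i j) => [->//|ij]; apply: letterC.
by apply/(adjP labA); exists q, i, j.
Qed.

(** Edges between full simplices do not move in the group; loops are generators. *)
Definition edge_gen e : G := if wide A e.1 then 1 else gen (vtx e.1.+1 (side A e.1), e.2).

Fixpoint ev_flat p : G :=
  if p is (e, c) :: p' then
    ev_flat p' * zpow (vgen (flat_type A p') (edge_side A e)) c * edge_gen e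
  else 1.

Definition ev z : G := ev_flat z.1 * monomial (vgen (flat_type A z.1)) z.2.

Lemma edge_genV e : edge_gen (rev_edge e) = (edge_gen e)^-1.
Proof.
by rewrite /edge_gen /=; case: ifP => _; [rewrite invg1 | exact: letterV].
Qed.

Lemma vtx_across e j : e.1 < nsteps A -> j != edge_side A e ->
  vtx (edge_source A e) j = vtx (edge_target A e) j.
Proof.
move=> lt_e je; rewrite /edge_source /edge_target /=.
by case: (wide A e.1) => //; case: e.2 => /=; rewrite (vtx_host labA lt_e je).
Qed.

(** A loop commutes with the facet it is glued to, which spans its wall. *)
Lemma edge_genC e x : e.1 < nsteps A -> x (edge_side A e) = 0%R ->
  commute (edge_gen e) (monomial (vgen (edge_source A e)) x).
Proof.
move=> lt_e x0; apply: commute_monomial => j xj.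
have je : j != edge_side A e by apply: contraNneq xj => ->; rewrite x0.
rewrite /edge_gen; case: ifP => we; first exact/commute_sym/commute1.
have -> : edge_source A e = host A e.1 by rewrite /edge_source /edge_target /= we.
rewrite /vgen -(vtx_host labA lt_e je); apply: letterC.
by apply/(adjP labA); exists e.1.+1, (side A e.1), j; split=> //; rewrite eq_sym.
Qed.

Lemma edge_source_le e : e.1 < nsteps A -> edge_source A e <= nsteps A.
Proof. by move=> lt_e; apply/flat_index_le/(flat_index_target brA). Qed.

(** The coordinate [x_i] can be read before the crossing as well as after it,
    since all the other coordinates commute with the crossing. *)
Lemma ev_child e p x : e.1 < nsteps A -> edge_source A e = flat_type A p ->
  ev ((e, x (edge_side A e)) :: p, upd x (edge_side A e) 0%R) = ev (p, x) * edge_gen e.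
Proof.
move=> lt_e src_e; rewrite /ev /=; set i := edge_side A e.
rewrite (@monomial_split _ _ _ _ x i); last by move=> *; rewrite -src_e; exact/vgenC/edge_source_le.
rewrite -!mulgA; congr (_ * (_ * _)); rewrite -src_e -edge_genC ?upd_same //; congr (_ * _).
apply: eq_monomial => j xj; rewrite /vgen -vtx_across //.
by apply: contraNneq xj => ->; rewrite upd_same.
Qed.

Lemma ev_cross e z : based A (edge_source A e) z -> e.1 < nsteps A ->
  ev (cross A e z) = ev z * edge_gen e.
Proof.
case: z => p x [/= gp tp] lt_e; have e_out : e \in edges_from A (flat_type A p) (edge_side A e).
  by rewrite mem_edges_from lt_e tp !eqxx.
case: (crossP (z := (p, x)) gp e_out) => [c p' /= def_p x0|/= _]; last by rewrite ev_child.
have := @ev_child (rev_edge e) p' (upd x (edge_side A e) c).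
rewrite [edge_side A (rev_edge e)]/(edge_side A e) upd_same edge_genV.
have -> : upd (upd x (edge_side A e) c) (edge_side A e) 0%R = x by rewrite upd_upd -x0 upd_id.
move=> ev_p; rewrite def_p ev_p ?mulgVK //.
by have := gp; rewrite /good def_p /= mem_edges_from => /and3P[_ _ /and3P[_ /eqP]].
Qed.

Lemma ev_move i b z : flat_type A z.1 <= nsteps A ->
  ev (move i b z) = ev z * gen (vtx (flat_type A z.1) i, b).
Proof.
by move=> le_z; rewrite /ev /= monomial_shift ?mulgA ?(genE _ b) // => i' j; exact: vgenC.
Qed.

Lemma ev_go q z : q <= nsteps A -> flat_index A q -> based A 0 z -> ev (go A q z) = ev z.
Proof.
elim/ltn_ind: q => -[|k] IHk lt_k //; rewrite /= lt_k /= => wk bz.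
have le_h := host_le brA lt_k; have le_h' := leq_trans le_h (ltnW lt_k).
have flat_h := host_flat brA lt_k; have [bh _] := go_based brA le_h' flat_h bz.
rewrite (goS brA) // ev_cross //; last by rewrite /edge_source /edge_target /= andbF.
by rewrite /edge_gen wk mulg1; apply: IHk.
Qed.

Lemma ev_goback q z : q <= nsteps A -> flat_index A q -> based A q z ->
  ev (goback A q z) = ev z.
Proof.
move=> le_q flat_q bz; have [bb _] := goback_based brA le_q flat_q bz.
rewrite -(ev_go le_q flat_q bb) gobackK //; by have [/andP[]] := bz.
Qed.

Lemma edge_end_loop k b : ~~ wide A k -> edge_target A (k, b) = host A k.
Proof. by rewrite /edge_target /= => /negPf->. Qed.

Lemma ev_act a z : based A 0 z -> ev (act a z) = ev z * gen a.
Proof.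
move=> bz; rewrite /letter_act; case: ifP => [flat_v|/negbT].
  have le_v := born_le labA a.1; have [bg _] := go_based brA le_v flat_v bz.
  rewrite ev_goback // ev_move ?(proj2 bg) // ev_go // (vtx_born labA).
  by case: (a).
move=> /(born_host brA labA) [k def_k [lt_k wk side_k]].
have flat_h := host_flat brA lt_k; have le_h := flat_index_le flat_h.
have [bh _] := go_based brA le_h flat_h bz.
have bh' : based A (edge_source A (k, a.2)) (go A (host A k) z).
  by rewrite /edge_source edge_end_loop.
have [bc _] := cross_based brA bh' lt_k; rewrite edge_end_loop // in bc.
rewrite def_k /= ev_goback // ev_cross // ev_go // /edge_gen /= (negPf wk) side_k -def_k.
by rewrite (vtx_born labA); case: (a).
Qed.

(** Evaluation turns the action of a letter into multiplication by it. *)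
Lemma reachK : cancel reach ev.
Proof.
elim/presented_group_ind=> [|g a IHg].
  rewrite reach1 /ev /= mul1g /monomial big1 // => i _.
  by rewrite ffunE.
by rewrite reach_mul ev_act ?IHg //; exact: reach_based.
Qed.

(** The group element of [z] reaches [z] itself once it is transported to the
    flats of the same type. *)
Definition returns z := go A (flat_type A z.1) (reach (ev z)) = z.

Lemma reach_reduced (g : G) : reduced (reach g).1.
Proof. by have [/andP[]] := reach_based g. Qed.

Lemma returns_move i b z : good A z.1 -> returns z -> returns (move i b z).
Proof.
move=> gz rz; have /andP[_ /(flat_index_type brA) flat_z] := gz.
have le_z := flat_index_le flat_z; rewrite /returns ev_move // reach_mul.
rewrite (act_vtx brA labA) ?reach_reduced // gobackK /= ?go_reduced ?reach_reduced //.
by rewrite rz.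
Qed.

Lemma returns_cross e z : based A (edge_source A e) z -> e.1 < nsteps A ->
  returns z -> returns (cross A e z).
Proof.
move=> bz lt_e rz; have [[_ type_c] _] := cross_based brA bz lt_e.
rewrite /returns type_c ev_cross // /edge_gen; rewrite /returns (proj2 bz) in rz.
set R := reach (ev z) in rz *; have rR : reduced R.1 := reach_reduced _.
have flat_h := host_flat brA lt_e; have le_h := flat_index_le flat_h.
case: ifP => [we|/negbT we].
  rewrite mulg1 -/R -rz; case: e lt_e we {bz rz type_c flat_h le_h} => k [] /= lt_k wk.
    rewrite /edge_source /edge_target /= wk andbF /= (goS brA) //.
    by rewrite (crossK A (k, false)) // go_reduced.
  by rewrite /edge_source /edge_target /= wk andbF /= (goS brA).
case: e bz lt_e we rz flat_h le_h {type_c} => k b bz /= lt_k wk.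
rewrite /edge_source !edge_end_loop // => rz flat_h le_h.
rewrite reach_mul -/R (act_new labA) // gobackK ?rz // cross_reduced //.
by have [/andP[]] := bz.
Qed.

Lemma go_reach z : good A z.1 -> returns z.
Proof.
case: z => p x; elim: p x => [|[e c] p IHp] x /= gp.
  apply: (@coords_ind _ (fun x => returns ([::], x)) [ffun=> 0%R]).
    have ev_base : ev base = 1 by rewrite -reach1 reachK.
    by rewrite -/base /returns ev_base reach1.
  by move=> {}x i b rx; apply: (@returns_move i b ([::], x)).
have gp' : good A p by have /andP[/= /andP[rp _] /andP[tp _]] := gp; rewrite /good rp tp.
have /andP[_ /= /andP[_]] := gp; rewrite mem_edges_from => /and3P[lt_e /eqP src_e _].
apply: (@coords_ind _ (fun x => returns ((e, c) :: p, x)) (upd x (edge_side A e) 0%R)).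
  have := @returns_cross e (p, upd x (edge_side A e) c).
  rewrite cross_child ?upd_same // upd_upd; apply=> //; exact: IHp.
by move=> {}x i b rx; apply: (@returns_move i b (_, x)).
Qed.

Definition gen_seq : seq G := [seq gen (v, false) | v <- enum V].

Lemma mem_gen_seq v : gen (v, false) \in gen_seq.
Proof. by apply: map_f; rewrite mem_enum. Qed.

Lemma gen_seq_generates : generates gen_seq.
Proof.
elim/presented_group_ind=> [|g [v b] [w Sw <-]].
  by exists [::]; rewrite // /word_value big_nil.
exists (rcons w (gen (v, false), b)).
  by rewrite /word_over all_rcons /= mem_gen_seq.
by rewrite /word_value -cats1 big_cat big_seq1 /= [in RHS]genE.
Qed.

Local Notation gdist := (dist gen_seq_generates).

Lemma dist_letter (g : G) a : gdist g (g * gen a) <= 1.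
Proof. by case: a => v b; rewrite genE; apply: dist_gen; exact: mem_gen_seq. Qed.

Lemma dist_edge (g : G) e : gdist g (g * edge_gen e) <= 1.
Proof.
by rewrite /edge_gen; case: ifP => _; [rewrite mulg1 dist_refl | exact: dist_letter].
Qed.

Lemma dist_zpow (g : G) v c : gdist g (g * zpow (gen (v, false)) c) <= `|c|%N.
Proof.
have step k b : gdist g (g * zpow (gen (v, false)) (Posz k * unit_step b)%R) <= k.
  elim: k => [|k IHk]; first by rewrite mul0r mulg1 dist_refl.
  have -> : (Posz k.+1 * unit_step b = Posz k * unit_step b + unit_step b)%R by lia.
  rewrite zpow_step -genE mulgA -addn1.
  by apply: leq_trans (dist_trans _ _ _ _) _; last exact: leq_add IHk (dist_letter _ _).
case: (lerP 0 c) => c0; [have := step `|c|%N false | have := step `|c|%N true].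
  by rewrite /unit_step mulr1; have -> : Posz `|c|%N = c by lia.
by rewrite /unit_step mulrN1; have -> : (- Posz `|c|%N)%R = c by lia.
Qed.

Lemma zpowD (g : G) c d : zpow g (c + d)%R = zpow g c * zpow g d.
Proof.
elim/int_ind_unit: d => [|d b IHd]; first by rewrite addr0 mulg1.
by rewrite addrA !zpow_step IHd mulgA.
Qed.

(** In the group, the line through a point in direction [i] is the orbit of a
    generator. *)
Lemma dist_upd p x i c c' : flat_type A p <= nsteps A ->
  gdist (ev (p, upd x i c)) (ev (p, upd x i c')) <= `|c - c'|%N.
Proof.
move=> le_p; have split d : ev (p, upd x i d) =
    ev_flat p * monomial (vgen (flat_type A p)) (upd x i 0%R) * zpow (vgen (flat_type A p) i) d.
  rewrite /ev /= (@monomial_split _ _ _ _ (upd x i d) i); last by move=> *; exact: vgenC.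
  rewrite upd_same upd_upd -mulgA; congr (_ * _); apply/commute_sym/commute_zpow/commute_sym.
  by apply: commute_monomial => j _; exact: vgenC.
rewrite !split; have -> : (c' = c + (c' - c))%R by lia.
rewrite zpowD mulgA; apply: leq_trans (dist_zpow _ _ _) _; lia.
Qed.

Definition point_of (y : tree_point n) : G := ev ((slide A y.1).1, y.2).

(** The new neighbour of a flat behind a wall is a child behind a nearby wall,
    or a sibling sharing with the flat a wall that is not far from the point. *)
Lemma point_of_linked y y' : linked y y' ->
  gdist (point_of y) (point_of y') <= (waiting_bound A).+2.
Proof.
have le_type p : good A p -> flat_type A p <= nsteps A.
  by move=> /andP[_ tp]; apply/flat_index_le/(flat_index_type brA).
have good_s y0 := good_slide brA y0.
have point_ofE y0 x : point_of (y0, x) = ev ((slide A y0).1, x) by [].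
have down y0 x i : gdist (point_of (y0, x)) (point_of ((i, x i) :: y0, upd x i 0%R)) <=
    (waiting_bound A).+2.
  have child e c' : (slide A ((i, x i) :: y0)).1 = (e, c') :: (slide A y0).1 ->
      edge_side A e = i -> `|(x i - c')%R|%N <= waiting_bound A ->
      gdist (point_of (y0, x)) (point_of ((i, x i) :: y0, upd x i 0%R)) <= (waiting_bound A).+2.
    move=> def_s side_e le_c; have := good_s ((i, x i) :: y0); rewrite def_s => g_s.
    have /andP[_ /= /andP[_]] := g_s; rewrite mem_edges_from => /and3P[lt_e /eqP src_e _].
    have := @ev_child e (slide A y0).1 (upd x i c') lt_e src_e.
    rewrite side_e upd_same upd_upd !point_ofE -def_s => ->.
    apply: leq_trans (dist_trans _ _ (ev ((slide A y0).1, upd x i c')) _) _.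
    rewrite -addn2; apply: leq_add; last exact: leq_trans (dist_edge _ _) _.
    rewrite -{1}(upd_id x i); apply: leq_trans le_c; apply: dist_upd; exact: le_type.
  have [_ _ /(_ i) [_ le_w w_y]] := slide_invP brA y0.
  case: (slot_cases (slide A y0) i (x i)) => [[k def_c lt_k]|[c' c'0 def_c]].
    have def_s : (slide A ((i, x i) :: y0)).1 = nth [::] ((slide A y0).2 i) k.
      by rewrite /= def_c slot_waiting.
    have [nb _] := w_y _ (mem_nth [::] lt_k); rewrite -def_s in nb.
    have le_k : k <= waiting_bound A by apply: leq_trans (ltnW lt_k) (leq_trans le_w (leqnSn _)).
    case: nb => [[e [def_g side_e _]]|[e [e' [c [f [def_p def_g side_e side_e' _]]]]]].
      by apply: (child e 0%R def_g side_e); rewrite def_c; lia.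
    have gp := good_s y0; rewrite def_p in gp.
    have gg := good_s ((i, x i) :: y0); rewrite def_g in gg.
    have /andP[_ /= /andP[tf]] := gp; rewrite mem_edges_from => /and3P[lt_e /eqP src_e _].
    have /andP[_ /= /andP[_]] := gg; rewrite mem_edges_from => /and3P[lt_e' /eqP src_e' _].
    have := @ev_child e f (upd x i c) lt_e src_e.
    have := @ev_child e' f (upd x i c) lt_e' src_e'.
    rewrite side_e side_e' upd_same upd_upd !point_ofE -def_p -def_g => -> ev_p.
    apply: leq_trans (dist_trans _ _ (ev ((slide A y0).1, upd x i 0%R)) _) _.
    rewrite -addn2 -[2]/(1 + 1); apply: leq_add.
      apply: (@leq_trans `|(x i - 0)%R|%N); last by rewrite def_c; lia.
      by rewrite -{1}(upd_id x i); apply: dist_upd; exact: le_type.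
    apply: leq_trans (dist_trans _ _ (ev (f, upd x i c)) _) _.
    by rewrite ev_p; apply: leq_add (dist_edge _ _); rewrite dist_sym dist_edge.
  have [e [def_h side_e gg _]] := first_child brA i (good_s y0) c'0.
  apply: (child e c') => //; first by rewrite /= [in LHS]def_c slot_child.
  rewrite def_c /waiting_bound; move: (size _) le_w => w.
  case: (c') => [[|k]|k] /=; lia.
case=> [p x i b|p x i|p x i]; [|exact: down|by rewrite dist_sym; exact: down].
have -> : point_of (p, shift i b x) = ev (move i b ((slide A p).1, x)) by [].
rewrite ev_move; first exact: leq_trans (dist_letter _ _) _.
exact/le_type/good_s.
Qed.

(** The reached points are shuffled by [unslide] in one direction and unshuffled
    by [slide] in the other. *)
Theorem raag_coarse_tree : coarse_tree n G.
Proof.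
exists gen_seq, gen_seq_generates, (fun g => unslide_point A (reach g)), point_of.
exists (act_bound A + (nsteps A * cross_bound A + (waiting_bound A).+2)); split.
- move=> g s /mapP[v _ ->]; rewrite reach_mul.
  have [_] := act_based brA labA (v, false) (reach_based g); apply: within_le.
  exact: leq_addr.
- by move=> y y' /point_of_linked /leq_trans -> //; rewrite addnA leq_addl.
- move=> g; rewrite /point_of /= (unslideK brA); last exact: (proj1 (reach_based g)).
  by rewrite -surjective_pairing reachK.
move=> [y x]; have gz : good A (slide A y).1 := good_slide brA y.
pose z : flat_point n := ((slide A y).1, x).
have /andP[_ /(flat_index_type brA) flat_z] := gz; have le_z := flat_index_le flat_z.
have [_] := go_based brA le_z flat_z (reach_based (ev z)).
rewrite (go_reach (z := z) gz) {2}/unslide_point /= (slideK brA) /point_of /=.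
apply: within_le; rewrite addnCA (leq_trans _ (leq_addr _ _)) //.
by rewrite leq_mul2r le_z orbT.
Qed.

End Evaluation.

(** * Building a complex simplex by simplex *)

Section Stacked.
Variable n : nat.

(** Each new simplex meets the union of the older ones in a facet. *)
Inductive stacked (V : finType) : seq {set V} -> Prop :=
| stacked1 (s : {set V}) : #|s| = n.+1 -> stacked [:: s]
| stacked_rcons (l : seq {set V}) (t : {set V}) v (s' : {set V}) :
    stacked l -> (forall s : {set V}, s \in l -> v \notin s) ->
    #|t| = n -> s' \in l -> t \subset s' -> stacked (rcons l (v |: t)).

Lemma stacked_neq_nil (V : finType) (l : seq {set V}) : stacked l -> l != [::].
Proof. by case=> [//|l' t v s' _ _ _ _ _]; case: l'. Qed.

Lemma stacked_card (V : finType) (l : seq {set V}) s : stacked l -> s \in l -> #|s| = n.+1.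
Proof.
elim=> [s0 card_s0|l' t v s' _ IH v_new card_t s'l ts']; first by rewrite inE => /eqP->.
rewrite mem_rcons inE => /predU1P[->|]; last exact: IH.
by rewrite cardsU1 card_t (contra (subsetP ts' v) (v_new _ s'l)).
Qed.

Lemma mem_head_stacked (V : finType) (l : seq {set V}) : stacked l -> head set0 l \in l.
Proof. by move=> /stacked_neq_nil; case: l => // s l _; apply: mem_head. Qed.

(** A gluing along a facet adds to the first stacking the simplices of the second
    one.  The second stacking has to start with a simplex that contains the
    facet, so that this simplex too brings exactly one new vertex; hence the
    interest in stackings with a prescribed first simplex. *)
Lemma stacked_join (V1 V2 V : finType) (i1 : V1 -> V) (i2 : V2 -> V)
    (s1 : {set V1}) (s2 : {set V2}) (l1 : seq {set V1}) (l2 : seq {set V2}) s :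
  injective i1 -> injective i2 -> i1 @: s1 = i2 @: s2 ->
  (forall x y, i1 x = i2 y -> y \in s2) -> #|s2| = n ->
  stacked l1 -> s \in l1 -> s1 \subset s -> stacked l2 -> s2 \subset head set0 l2 ->
  stacked ([seq i1 @: (t : {set V1}) | t <- l1] ++ [seq i2 @: (t : {set V2}) | t <- l2]).
Proof.
move=> inj1 inj2 s12 meet card_s2 st1 sl1 s1s st2.
have new2 v t : v \notin s2 -> i2 v \notin i1 @: (t : {set V1}).
  by move=> vs2; apply: contra vs2 => /imsetP[x _ /esym /meet].
have im_new (A2 : {set V2}) v : v \notin A2 -> i2 v \notin i2 @: A2.
  by apply: contra => /imsetP[y yA /inj2->].
have st1' : stacked [seq i1 @: (t : {set V1}) | t <- l1].
  have {st1 sl1 s1s} : stacked l1 by []; elim=> [s0 card_s0|l t v s' _ IH v_new card_t s'l ts'].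
    by apply: stacked1; rewrite card_imset.
  rewrite map_rcons imsetU1; apply: (stacked_rcons (s' := i1 @: s')) => //.
  - by move=> _ /mapP[u ul ->]; apply: contra (v_new _ ul) => /imsetP[y yu /inj1->].
  - by rewrite card_imset.
  - exact: map_f.
  - exact: imsetS.
elim: st2 => [s0 card_s0|l t v s' stl IH v_new card_t s'l ts'] /= s2_head.
  have [v vs0 vs2] : exists2 v, v \in s0 & v \notin s2.
    apply/subsetPn; apply/negP=> /subset_leq_card.
    by rewrite card_s0 card_s2 ltnn.
  have -> : s0 = v |: s2.
    apply/esym/eqP; rewrite eqEcard subUset sub1set vs0 s2_head cardsU1 vs2 card_s0 card_s2.
    by rewrite leqnn.
  rewrite cats1 imsetU1; apply: (stacked_rcons (s' := i1 @: s)) => //.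
  - by move=> _ /mapP[u _ ->]; apply: new2.
  - by rewrite card_imset.
  - exact: map_f.
  - by rewrite -s12; apply: imsetS.
have hd_l : head set0 (rcons l (v |: t)) = head set0 l.
  by have := stacked_neq_nil stl; case: (l).
rewrite hd_l in s2_head; have hl := mem_head_stacked stl.
have vs2 : v \notin s2 by apply: contra (subsetP s2_head v) (v_new _ hl).
rewrite map_rcons -rcons_cat imsetU1; apply: (stacked_rcons (s' := i2 @: s')).
- exact: IH.
- move=> u; rewrite mem_cat => /orP[/mapP[u1 _ ->]|/mapP[u2 u2l ->]]; first exact: new2.
  exact/im_new/v_new.
- by rewrite card_imset.
- by rewrite mem_cat map_f ?orbT.
- exact: imsetS.
Qed.

Definition spans (K : simplicial_complex) (l : seq {set vert K}) : Prop :=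
  forall t : {set vert K}, t \in faces K <->
    t != set0 /\ exists2 s : {set vert K}, s \in l & t \subset s.

Lemma spans_simplex (K : simplicial_complex) l s : stacked l -> spans l -> s \in l ->
  s \in simplices K n.
Proof.
move=> st sp sl; have card_s := stacked_card st sl.
rewrite inE card_s eqxx andbT; apply/sp; split; last by exists s.
by rewrite -card_gt0 card_s.
Qed.

Lemma simplex_stacked (K : simplicial_complex) l s : stacked l -> spans l ->
  s \in simplices K n -> s \in l.
Proof.
move=> st sp; rewrite inE => /andP[/sp [_ [s' s'l ss']] /eqP card_s].
suff -> : s = s' by [].
by apply/eqP; rewrite eqEcard ss' card_s (stacked_card st s'l) leqnn.
Qed.

Lemma spans_union (K1 K2 K : simplicial_complex) (i1 : vert K1 -> vert K) (i2 : vert K2 -> vert K)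
    l1 l2 :
  injective i1 -> injective i2 ->
  faces K = [set i1 @: (t : {set vert K1}) | t in faces K1] :|:
            [set i2 @: (t : {set vert K2}) | t in faces K2] ->
  spans l1 -> spans l2 ->
  spans ([seq i1 @: (t : {set vert K1}) | t <- l1] ++ [seq i2 @: (t : {set vert K2}) | t <- l2]).
Proof.
have sub_im (K0 : simplicial_complex) (i : vert K0 -> vert K) (l : seq {set vert K0}) t :
    injective i -> spans l ->
    t \in [set i @: (t : {set vert K0}) | t in faces K0] <->
    t != set0 /\ exists2 s, s \in [seq i @: (t : {set vert K0}) | t <- l] & t \subset s.
  move=> inj_i sp; split=> [/imsetP[t0 /sp[t0N [s sl t0s]] ->]|[tN [_ /mapP[s sl ->] ts]]].
    split; last by exists (i @: s); [exact: map_f | exact: imsetS].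
    by rewrite -card_gt0 card_imset // card_gt0.
  have def_t : t = i @: (i @^-1: t).
    apply/setP=> x; apply/idP/imsetP=> [xt|[y + ->]]; last by rewrite inE.
    by have /imsetP[y _ def_x] := subsetP ts x xt; exists y; rewrite // inE -def_x.
  rewrite {1}def_t; apply: imset_f; apply/sp; split.
    by apply: contraNneq tN => t0; rewrite def_t t0 imset0.
  exists s => //; apply/subsetP=> y; rewrite inE => /(subsetP ts) /imsetP[y' y's /inj_i->].
  exact: y's.
move=> inj1 inj2 faceE sp1 sp2 t; rewrite faceE in_setU; split.
  case/orP=> [/(sub_im _ _ _ _ inj1 sp1)|/(sub_im _ _ _ _ inj2 sp2)] [tN [s sl ts]];
    by split=> //; exists s; rewrite // mem_cat sl ?orbT.
move=> [tN [s]]; rewrite mem_cat => /orP[sl ts|sl ts]; apply/orP.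
  by left; apply/(sub_im _ _ _ _ inj1 sp1); split=> //; exists s.
by right; apply/(sub_im _ _ _ _ inj2 sp2); split=> //; exists s.
Qed.

Definition stackable (K : simplicial_complex) : Prop :=
  (exists s, s \in simplices K n) /\
  forall s, s \in simplices K n ->
    exists l : seq {set vert K}, [/\ stacked l, spans l & head set0 l = s].

Lemma stackable_facet (K : simplicial_complex) t : stackable K -> t \in faces K ->
  exists l : seq {set vert K}, [/\ stacked l, spans l & t \subset head set0 l].
Proof.
move=> [[s0 s0K] stk] tK; have [l [st sp _]] := stk _ s0K.
have [_ [s sl ts]] := proj1 (sp t) tK.
by have [l' [st' sp' hd]] := stk _ (spans_simplex st sp sl); exists l'; rewrite hd.
Qed.

(** The first simplex is taken in [K1]; the case of [K2] is obtained by exchanging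
    the two complexes. *)
Lemma stackable_join (K1 K2 K : simplicial_complex)
    (i1 : vert K1 -> vert K) (i2 : vert K2 -> vert K)
    (s1 : {set vert K1}) (s2 : {set vert K2}) :
  injective i1 -> injective i2 -> i1 @: s1 = i2 @: s2 ->
  (forall x y, i1 x = i2 y -> y \in s2) -> #|s2| = n ->
  s1 \in faces K1 -> s2 \in faces K2 ->
  faces K = [set i1 @: (t : {set vert K1}) | t in faces K1] :|:
            [set i2 @: (t : {set vert K2}) | t in faces K2] ->
  stackable K1 -> stackable K2 -> forall s, s \in simplices K1 n ->
  exists l : seq {set vert K}, [/\ stacked l, spans l & head set0 l = i1 @: s].
Proof.
move=> inj1 inj2 s12 meet card_s2 s1K s2K faceE [_ stk1] stk2 s /stk1 [l1 [st1 sp1 hd1]].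
have [l2 [st2 sp2 s2hd]] := stackable_facet stk2 s2K.
exists ([seq i1 @: (t : {set vert K1}) | t <- l1] ++ [seq i2 @: (t : {set vert K2}) | t <- l2]).
have [_ [u ul s1u]] := proj1 (sp1 s1) s1K; split.
- exact: (stacked_join inj1 inj2 s12 meet card_s2 st1 ul s1u st2 s2hd).
- exact: spans_union.
by rewrite -hd1; have := stacked_neq_nil st1; case: (l1).
Qed.

Lemma in_T_stackable (K : simplicial_complex) : 1 <= n -> in_T n K -> stackable K.
Proof.
move=> n1; elim=> {K} [K card_K fullK|K1 K2 K s1 s2 phi _ stk1 _ stk2 s1K s2K].
  have top_simplex : [set: vert K] \in simplices K n by rewrite inE fullK cardsT card_K eqxx.
  split=> [|s]; first by exists setT.
  rewrite inE => /andP[_ /eqP card_s]; have -> : s = setT.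
    by apply/eqP; rewrite eqEcard subsetT cardsT card_K card_s leqnn.
  exists [:: setT]; split=> //; first by apply: stacked1; rewrite cardsT.
  move=> t; split=> [tK|[tN _]]; last exact: faces_down_closed fullK (subsetT _) tN.
  split; last by exists setT; rewrite ?mem_head.
  by apply: contraTneq tK => ->; apply: set0_notin_faces.
move=> [inj_phi phi_s [i1 [i2 [inj1 inj2 glue faceE]]]].
have dimS : n.-1.+1 = n by case: (n) n1.
have := s1K; rewrite inE dimS => /andP[f1 /eqP card1].
have := s2K; rewrite inE dimS => /andP[f2 /eqP card2].
have s12 : i1 @: s1 = i2 @: s2.
  rewrite -phi_s -imset_comp; apply: eq_in_imset => x xs1 /=.
  by apply/glue.
have meet1 x y : i1 x = i2 y -> y \in s2.
  by move=> /glue [xs1 ->]; rewrite -phi_s imset_f.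
have meet2 y x : i2 y = i1 x -> x \in s1 by move=> /esym /glue [].
have faceE' : faces K = [set i2 @: (t : {set vert K2}) | t in faces K2] :|:
    [set i1 @: (t : {set vert K1}) | t in faces K1] by rewrite setUC.
split.
  have [[s] ] := stk1; rewrite inE => /andP[sK card_s] _; exists (i1 @: s).
  by rewrite inE card_imset // card_s andbT faceE inE imset_f.
move=> s; rewrite inE faceE in_setU => /andP[/orP[]/imsetP[s' s'K ->]];
  rewrite card_imset // => card_s'.
  apply: (stackable_join inj1 inj2 s12 meet1) => //; by rewrite inE s'K.
apply: (stackable_join inj2 inj1 (esym s12) meet2) => //; by rewrite inE s'K.
Qed.

End Stacked.

Section Colouring.
Variables (n : nat) (V : finType).
Implicit Types (l : seq {set V}) (s t : {set V}).

Lemma stacked_nth l k : stacked n l -> k.+1 < size l ->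
  exists v t, [/\ nth set0 l k.+1 = v |: t, forall j, j <= k -> v \notin nth set0 l j,
    #|t| = n & exists2 j, j <= k & t \subset nth set0 l j].
Proof.
elim=> [//|{}l t v s' st IH v_new card_t s'l ts']; rewrite size_rcons ltnS leq_eqVlt.
case/predU1P=> [sz_l|lt_k].
  have nth_l j : j <= k -> nth set0 (rcons l (v |: t)) j = nth set0 l j.
    by move=> le_j; rewrite nth_rcons -sz_l ltnS le_j.
  exists v, t; split=> // [|j le_j|]; first by rewrite nth_rcons sz_l ltnn eqxx.
    by rewrite nth_l // v_new // mem_nth // -sz_l ltnS.
  exists (index s' l); first by rewrite -ltnS sz_l index_mem.
  by rewrite nth_l ?nth_index // -ltnS sz_l index_mem.
have nth_l j : j <= k.+1 -> nth set0 (rcons l (v |: t)) j = nth set0 l j.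
  by move=> le_j; rewrite nth_rcons (leq_ltn_trans le_j lt_k).
have [v1 [t1 [def_k v1_new card_t1 [j le_j t1j]]]] := IH lt_k.
exists v1, t1; split=> // [|i le_i|]; first by rewrite nth_l.
  by rewrite nth_l ?v1_new // leqW.
by exists j => //; rewrite nth_l // leqW.
Qed.

(** A facet leaves a colour free for the new vertex. *)
Lemma stacked_colouring l : stacked n l ->
  exists col : V -> 'I_n.+1, forall s, s \in l -> {in s &, injective col}.
Proof.
elim=> [s card_s|{}l t v s' st [col colP] v_new card_t s'l ts'].
  exists (fun x => inord (index x (enum s))) => s0; rewrite inE => /eqP-> x y xs ys.
  move=> /(congr1 val); rewrite /= !inordK; last 2 first.
  - by rewrite -card_s cardE index_mem mem_enum.
  - by rewrite -card_s cardE index_mem mem_enum.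
  by apply: (index_inj x); rewrite mem_enum.
have [d dN] : exists d, d \notin col @: t.
  have /subsetPn[d _ dN] : ~~ ([set: 'I_n.+1] \subset col @: t); last by exists d.
  apply/negP=> /subset_leq_card; rewrite cardsT card_ord => /leq_trans/(_ (leq_imset_card _ _)).
  by rewrite card_t ltnn.
exists (fun x => if x == v then d else col x) => s.
rewrite mem_rcons inE => /predU1P[->|sl] x y; last first.
  move=> xs ys; have vs := v_new _ sl.
  have /negPf -> : x != v by apply: contraNneq vs => <-.
  have /negPf -> : y != v by apply: contraNneq vs => <-.
  exact: colP xs ys.
have tN x0 : x0 \in t -> x0 == v = false.
  by move=> xt; apply: contraNF (v_new _ s'l) => /eqP <-; apply: subsetP xt.
rewrite !inE => /predU1P[->|xt] /predU1P[->|yt]; rewrite ?eqxx //.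
- by rewrite tN // => def_d; rewrite def_d imset_f in dN.
- by rewrite tN // => def_d; rewrite -def_d imset_f in dN.
by rewrite !tN //; apply: (colP _ s'l); apply: (subsetP ts').
Qed.

End Colouring.

Lemma facet_glued n (K : simplicial_complex) (s s' t : {set vert K}) :
  1 <= n -> s \in simplices K n -> s' \in simplices K n -> s' != s ->
  #|t| = n -> t \subset s -> t \subset s' -> t \in glued_facets n s.
Proof.
move=> n1; have dimS : n.-1.+1 = n by case: (n) n1.
rewrite !inE => /andP[sK _] /andP[s'K card_s'] ne_s card_t ts ts'.
rewrite dimS card_t eqxx ts (faces_down_closed sK ts) -?card_gt0 ?card_t //=.
by apply/existsP; exists s'; rewrite inE s'K card_s' ne_s.
Qed.

Lemma glued_facetsP n (K : simplicial_complex) (s t : {set vert K}) :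
  t \in glued_facets n s -> t \subset s /\
  exists s', [/\ s' \in simplices K n, s' != s & t \subset s'].
Proof.
rewrite inE => /andP[_ /andP[ts /existsP[s' /andP[s'K /andP[ne_s ts']]]]].
by split=> //; exists s'.
Qed.

(** A simplex with [n+1] vertices has no more than [n+1] facets. *)
Lemma all_facets_glued n (K : simplicial_complex) (s : {set vert K}) (t : {set vert K}) :
  1 <= n -> #|s| = n.+1 -> #|glued_facets n s| = n.+1 -> t \subset s -> #|t| = n ->
  t \in glued_facets n s.
Proof.
move=> n1 card_s card_g ts card_t; have dimS : n.-1.+1 = n by case: (n) n1.
have sub : glued_facets n s \subset [set B : {set vert K} | B \subset s & #|B| == n].
  by apply/subsetP=> B; rewrite !inE dimS => /andP[/andP[_ ->] /andP[->]].
have := sub; rewrite subEproper => /predU1P[->|/proper_card].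
  by rewrite inE ts card_t eqxx.
by rewrite card_g cards_draws card_s binSn ltnn.
Qed.

(** * From the building order to an assembly *)

Section Indexing.
Variables (n : nat) (K : simplicial_complex) (l : seq {set vert K}) (col : vert K -> 'I_n.+1).
Hypotheses (n1 : 1 <= n) (st : stacked n l) (sp : spans l).
Hypothesis colP : forall s : {set vert K}, s \in l -> {in s &, injective col}.
Implicit Types (q k j : nat) (i : 'I_n.+1) (x v w : vert K).

Let m := (size l).-1.
Let sx q : {set vert K} := nth set0 l q.

Lemma size_stacked : size l = m.+1.
Proof. by rewrite /m; have := stacked_neq_nil st; case: (l). Qed.

Lemma mem_sx q : q <= m -> sx q \in l.
Proof. by move=> le_q; rewrite mem_nth // size_stacked. Qed.

Lemma card_sx q : q <= m -> #|sx q| = n.+1.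
Proof. by move=> /mem_sx; exact: stacked_card. Qed.

Lemma sx_simplex q : q <= m -> sx q \in simplices K n.
Proof. by move=> /mem_sx; exact: spans_simplex. Qed.

Lemma simplex_sx s : s \in simplices K n -> exists2 q, q <= m & sx q = s.
Proof.
move=> /(simplex_stacked st sp) sl; exists (index s l); last exact: nth_index.
by rewrite -ltnS -size_stacked index_mem.
Qed.

Lemma vertex_exists : exists x : vert K, True.
Proof.
have : 0 < #|sx 0| by rewrite card_sx.
by move=> /card_gt0P[x _]; exists x.
Qed.

Let x0 : vert K := sval (cid vertex_exists).
Let vtx q i : vert K := odflt x0 [pick x in sx q | col x == i].

Lemma vtxP q i : q <= m -> vtx q i \in sx q /\ col (vtx q i) = i.
Proof.
move=> le_q; rewrite /vtx; case: pickP => [x /andP[xs /eqP]|no_x] //=.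
have : i \in col @: sx q.
  suff -> : col @: sx q = setT by rewrite inE.
  apply/eqP; rewrite eqEcard subsetT cardsT card_ord card_in_imset ?card_sx ?leqnn //.
  by move=> x y; apply: colP (mem_sx le_q) x y.
by case/imsetP=> x xs def_i; have := no_x x; rewrite /= xs def_i eqxx.
Qed.

Lemma vtx_col q x : q <= m -> x \in sx q -> vtx q (col x) = x.
Proof.
by move=> le_q xs; have [vs vc] := vtxP (col x) le_q; apply: (colP (mem_sx le_q)).
Qed.

Lemma new_vertex k : exists d, k < m ->
  (forall j, j <= k -> vtx k.+1 d \notin sx j) /\
  exists2 j, j <= k & sx k.+1 :\ vtx k.+1 d \subset sx j.
Proof.
case: (ltnP k m) => [lt_k|]; last by exists ord0.
have [|v [t [def_s v_new card_t [j le_j tj]]]] := @stacked_nth _ _ l k st.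
  by rewrite size_stacked.
have vs : v \in sx k.+1 by rewrite /sx def_s setU11.
exists (col v) => _; rewrite vtx_col //; split=> //; exists j => //.
rewrite /sx def_s setU1K //; apply: contra (v_new j le_j); exact: (subsetP tj).
Qed.

Let side_of k : 'I_n.+1 := sval (cid (new_vertex k)).

Let new k := vtx k.+1 (side_of k).
Let facet k := sx k.+1 :\ new k.
Let host_of k := find (fun s : {set vert K} => facet k \subset s) l.
Let wide_of k := #|glued_facets n (sx k.+1)| == n.+1.
Let born v := find (fun s : {set vert K} => v \in s) l.

Lemma find_sx (P : pred {set vert K}) j : P (sx j) -> find P l <= j.
Proof. by move=> Pj; rewrite leqNgt; apply/negP=> /(before_find set0); rewrite -/(sx j) Pj. Qed.

Lemma sx_find (P : pred {set vert K}) j : j <= m -> P (sx j) -> P (sx (find P l)).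
Proof. by move=> le_j Pj; apply: nth_find; apply/hasP; exists (sx j); rewrite ?mem_sx. Qed.

Lemma new_notin k j : k < m -> j <= k -> new k \notin sx j.
Proof. by move=> lt_k; have [+ _] := svalP (cid (new_vertex k)) lt_k; apply. Qed.

Lemma new_in k : k < m -> new k \in sx k.+1.
Proof. by move=> /(vtxP (side_of k)) []. Qed.

Lemma col_new k : k < m -> col (new k) = side_of k.
Proof. by move=> /(vtxP (side_of k)) []. Qed.

Lemma card_facet k : k < m -> #|facet k| = n.
Proof. by move=> lt_k; have := cardsD1 (new k) (sx k.+1); rewrite new_in // card_sx // => -[]. Qed.

Lemma host_of_le k : k < m -> host_of k <= k /\ facet k \subset sx (host_of k).
Proof.
move=> lt_k; have [_ [j le_j fj]] := svalP (cid (new_vertex k)) lt_k.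
split; first exact: leq_trans (@find_sx (fun s : {set vert K} => facet k \subset s) j fj) le_j.
exact: (@sx_find (fun s : {set vert K} => facet k \subset s) j (leq_trans le_j (ltnW lt_k)) fj).
Qed.

Lemma host_of_min k j : facet k \subset sx j -> host_of k <= j.
Proof. exact: (@find_sx (fun s : {set vert K} => facet k \subset s)). Qed.

Lemma sx_neq q q' : q <= m -> q' <= m -> q != q' -> sx q != sx q'.
Proof.
wlog lt_q : q q' / q < q' => [hw le_q le_q' |].
  rewrite neq_ltn => /orP[] lt_q; first by apply: hw; rewrite ?ltn_eqF.
  by rewrite eq_sym; apply: hw; rewrite ?ltn_eqF.
case: q' lt_q => [//|k] lt_q _ lt_k _; apply: contraNneq (new_notin lt_k lt_q) => ->.
exact: new_in.
Qed.

Lemma facet_glued_host k : k < m -> facet k \in glued_facets n (sx (host_of k)).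
Proof.
move=> lt_k; have [le_h fh] := host_of_le lt_k; have le_h' := leq_trans le_h (ltnW lt_k).
apply: (@facet_glued n K _ (sx k.+1)); rewrite ?sx_simplex ?card_facet ?subD1set //.
by rewrite sx_neq // eq_sym ltn_eqF.
Qed.

Lemma facet_glued_self k : k < m -> facet k \in glued_facets n (sx k.+1).
Proof.
move=> lt_k; have [le_h fh] := host_of_le lt_k; have le_h' := leq_trans le_h (ltnW lt_k).
apply: (@facet_glued n K _ (sx (host_of k))); rewrite ?sx_simplex ?card_facet ?subD1set //.
by rewrite sx_neq // ltn_eqF.
Qed.

Lemma adjacentP v w : adjacent v w <-> v != w /\ exists q, [/\ q <= m, v \in sx q & w \in sx q].
Proof.
rewrite /adjacent; split=> [/andP[-> /sp [_ [s sl vws]]]|[-> [q [le_q vq wq]]]].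
  split=> //; exists (index s l); rewrite /sx nth_index //; split.
  - by rewrite -ltnS -size_stacked index_mem.
  - by rewrite (subsetP vws) // !inE eqxx.
  - by rewrite (subsetP vws) // !inE eqxx orbT.
apply/sp; split; first by apply/set0Pn; exists v; rewrite !inE eqxx.
by exists (sx q); [exact: mem_sx | rewrite subUset !sub1set vq].
Qed.

Lemma vertex_covered v : exists2 q, q <= m & v \in sx q.
Proof.
have /sp [_ [s sl]] := vertex_in_faces v; rewrite sub1set => vs.
by exists (index s l); rewrite /sx ?nth_index // -ltnS -size_stacked index_mem.
Qed.

Let A : assembly n := Assembly m host_of side_of wide_of.

Lemma stacked_labelling : labelling A (@adjacent K) vtx born col.
Proof.
have born_sx v : born v <= m /\ v \in sx (born v).
  have [q le_q vq] := vertex_covered v.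
  have born_q := @find_sx (fun s : {set vert K} => v \in s) q vq.
  split; first exact: leq_trans born_q le_q.
  exact: (@sx_find (fun s : {set vert K} => v \in s) q).
split=> /=.
- by move=> q i /(vtxP i) [].
- move=> k i lt_k ik; have [le_h fh] := host_of_le lt_k.
  have [vs vc] := vtxP i lt_k; rewrite -{2}vc vtx_col //.
    exact: leq_trans le_h (ltnW lt_k).
  apply: (subsetP fh); rewrite in_setD1 vs andbT; apply: contraNneq ik => def_v.
  by rewrite -vc def_v col_new.
- move=> k lt_k; apply/eqP; rewrite eqn_leq; apply/andP; split.
    apply: (@find_sx (fun s : {set vert K} => _ \in s)); exact: new_in.
  rewrite ltnNge; apply/negP=> le_b; have [_] := born_sx (new k).
  by rewrite (negPf (new_notin lt_k le_b)).
- by move=> q i /(vtxP i) [vs _]; apply: (@find_sx (fun s : {set vert K} => _ \in s)).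
- by move=> v; have [] := born_sx v.
- by move=> v; have [le_b vb] := born_sx v; exact: vtx_col.
move=> v w; split=> [/adjacentP [vw [q [le_q vq wq]]]|[q [i [j [le_q ij -> ->]]]]].
  exists q, (col v), (col w); rewrite !vtx_col //; split=> //.
  by apply: contra vw => /eqP /(colP (mem_sx le_q) vq wq) ->.
have [vi ci] := vtxP i le_q; have [vj cj] := vtxP j le_q.
apply/adjacentP; split; last by exists q.
by apply: contra ij => /eqP; rewrite -{2}ci -{2}cj => ->.
Qed.

(** The facet of a new simplex is glued to its host, hence it is the unique glued
    facet of the host: by induction all simplices contain the same facet, and any of
    its vertices is joined to all the others. *)
Lemma single_facet_reducible :
  (forall s, s \in simplices K n -> #|glued_facets n s| = 1) -> reducible K.
Proof.
move=> single; have /eqP/cards1P[t def_g] := single _ (sx_simplex (leq0n m)).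
have g_uniq q t1 t2 : q <= m -> t1 \in glued_facets n (sx q) ->
    t2 \in glued_facets n (sx q) -> t1 = t2.
  by move=> le_q; have /eqP/cards1P[t0 ->] := single _ (sx_simplex le_q) => /set1P-> /set1P->.
have tg : t \in glued_facets n (sx 0) by rewrite def_g set11.
have dimS : n.-1.+1 = n by case: (n) n1.
have card_t : #|t| = n by have := tg; rewrite !inE dimS => /andP[/andP[_ /eqP]].
have t_sub q : q <= m -> t \subset sx q.
  elim/ltn_ind: q => -[|k] IHk lt_k; first by have [] := glued_facetsP tg.
  have [le_h _] := host_of_le lt_k; have le_hm := leq_trans le_h (ltnW lt_k).
  have t_h := IHk _ le_h le_hm; suff -> : t = facet k by apply: subD1set.
  apply: (g_uniq (host_of k)) => //; last exact: facet_glued_host.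
  case def_h: (host_of k) t_h le_hm => [|j] // t_h le_hm.
  apply: (@facet_glued n K _ (sx 0)); rewrite ?sx_simplex //; first exact: sx_neq.
  exact: IHk.
have /card_gt0P[x xt] : 0 < #|t| by rewrite card_t.
exists x => w xw; apply/adjacentP; split; first by rewrite eq_sym.
have [q le_q wq] := vertex_covered w; exists q; split=> //.
exact: subsetP (t_sub q le_q) x xt.
Qed.

Hypotheses (branched : maximally_branched n K) (full0 : #|glued_facets n (sx 0)| = n.+1).

Lemma wide_full q : flat_index A q -> q <= m /\ #|glued_facets n (sx q)| = n.+1.
Proof. by case: q => [|k] //= /andP[lt_k /eqP]. Qed.

(** If the host [j] of [k] had a single glued facet, this facet would
    at the same time be that of [k] and the one along which [j] was glued, so
    it would already lie in the host of [j], which is earlier. *)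
Lemma host_of_wide k : k < m -> flat_index A (host_of k).
Proof.
move=> lt_k; have [le_h fh] := host_of_le lt_k.
case def_h: (host_of k) le_h fh => [|j] //= lt_j fh; have lt_jm : j < m := ltn_trans lt_j lt_k.
rewrite lt_jm /wide_of.
case: (branched (sx_simplex lt_jm)) => [/eqP/cards1P[t def_g]|->]; last exact: eqxx.
have := facet_glued_host lt_k; rewrite def_h def_g => /set1P fk.
have := facet_glued_self lt_jm; rewrite def_g => /set1P fj.
have [le_hj fhj] := host_of_le lt_jm; rewrite fj -fk in fhj.
by have := host_of_min fhj; rewrite def_h leqNgt ltnS le_hj.
Qed.

(** The facet of simplex [q] opposite to the colour [i] lies in another simplex.
    If an earlier one contains it, it is the facet along which [q] was glued;
    otherwise a later simplex was glued to [q] along it. *)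
Lemma edges_from_wide q i : flat_index A q -> edges_from A q i != [::].
Proof.
move=> flat_q; have [le_q full_q] := wide_full flat_q; have [vq vc] := vtxP i le_q.
suff [e e_out] : exists e, e \in edges_from A q i by apply: contraTneq e_out => ->.
set t := sx q :\ vtx q i; have card_t : #|t| = n.
  by have := cardsD1 (vtx q i) (sx q); rewrite vq card_sx // => -[].
have earlier j : j < q -> t \subset sx j -> exists e, e \in edges_from A q i.
  move=> lt_j; case: q lt_j flat_q le_q {full_q} vq vc @t card_t => [//|k].
  move=> lt_j /andP[_ wk] lt_k vq vc t card_t tj.
  have def_i : side_of k = i.
    rewrite -vc -col_new //; congr col; apply/eqP; apply/negPn/negP=> ne_v.
    have : new k \in t by rewrite in_setD1 ne_v new_in.
    by move=> /(subsetP tj); rewrite (negPf (new_notin lt_k _)).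
  by exists (k, true); rewrite -def_i; exact: (@up_edge n A k lt_k wk).
have tg := all_facets_glued n1 (card_sx le_q) full_q (subD1set _ _) card_t.
have [_ [s' [/simplex_sx [j le_j <-] ne_j tj]]] := glued_facetsP tg.
case: (ltngtP j q) => [lt_j|lt_q|def_j]; last by rewrite def_j eqxx in ne_j.
  exact: earlier lt_j tj.
case: j le_j tj lt_q {ne_j} => [//|k] lt_k tk le_qk.
have ft : t = facet k.
  apply/eqP; rewrite eqEcard card_t card_facet // leqnn andbT subsetD1 tk /=.
  by apply: contra (new_notin lt_k le_qk) => /(subsetP (subD1set _ _)).
have := host_of_min (k := k) (j := q); rewrite -ft subD1set => /(_ isT).
rewrite leq_eqVlt => /predU1P[host_k|lt_h]; last first.
  by apply: earlier lt_h _; rewrite ft; have [] := host_of_le lt_k.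
have def_i : side_of k = i.
  have [vk ck] := vtxP i lt_k; rewrite -col_new // -ck; congr col; apply/eqP/negPn/negP=> ne_v.
  have vt : vtx k.+1 i \in t by rewrite ft in_setD1 eq_sym ne_v vk.
  have /(vtx_col le_q) : vtx k.+1 i \in sx q by apply: (subsetP (subD1set _ _)) vt.
  by rewrite ck => def_v; rewrite -def_v in_setD1 eqxx in vt.
(* A full neighbour gives a tree edge, any other a loop. *)
case: (boolP (wide_of k)) => wk; exists (k, false); rewrite -def_i -host_k.
  exact: (@down_edge n A k lt_k wk).
exact: (@loop_edge n A k false lt_k wk).
Qed.

Lemma stacked_branching : branching A.
Proof.
split=> /=; [by move=> k /host_of_le [] | exact: host_of_wide | exact: edges_from_wide].
Qed.

Theorem stacked_coarse_tree : coarse_tree n (n_tree_group K).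
Proof. exact: raag_coarse_tree stacked_branching stacked_labelling. Qed.

End Indexing.

Lemma exists_full_simplex n (K : simplicial_complex) :
  1 <= n -> stackable n K -> irreducible K -> maximally_branched n K ->
  exists2 s, s \in simplices K n & #|glued_facets n s| = n.+1.
Proof.
move=> n1 [[s0 s0K] stk] irr mb; apply: contrapT => no_full; apply: irr.
have [l [st sp _]] := stk _ s0K; have [col colP] := stacked_colouring st.
apply: (single_facet_reducible n1 st sp colP) => s sK.
by case: (mb s sK) => // full_s; case: no_full; exists s.
Qed.

Theorem n_tree_group_coarse_tree n (K : simplicial_complex) :
  1 <= n -> in_T n K -> irreducible K -> maximally_branched n K ->
  coarse_tree n (n_tree_group K).
Proof.
move=> n1 /(in_T_stackable n1) stkK irr mb.
have [s sK full_s] := exists_full_simplex n1 stkK irr mb.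
have [l [st sp hd]] := stkK.2 s sK; have [col colP] := stacked_colouring st.
by apply: (stacked_coarse_tree n1 st sp colP mb); rewrite nth0 hd.
Qed.

Theorem corollary1p2 (R : realType) (n : nat) (K K' : simplicial_complex) :
  1 <= n ->
  in_T n K -> in_T n K' ->
  irreducible K -> irreducible K' ->
  maximally_branched n K -> maximally_branched n K' ->
  quasi_isometric_groups R (n_tree_group K) (n_tree_group K').
Proof.
move=> n1 tK tK' irr irr' mb mb'.
by apply: (@coarse_tree_quasi_isometric R n); apply: n_tree_group_coarse_tree.
Qed.
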